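(* Let $d\in\mathbb N$, $\mathcal D=\{1,\dots,d\}$, $d_s\in\mathcal D$, $w:\mathbb Z^d\to[1,\infty)$ a weight function and $f\in\mathcal A^w(\mathbb T^d)$. Suppose there exists a subset of ANOVA terms $U\subseteq U_{d_s}$ and $\varepsilon_1>0$ such that $$\frac{\sum_{\mathbf k\in\mathbb F^{(d)}_{\mathbf u}}|c_{\mathbf k}(f)|}{\sum_{\mathbf k\in\mathbb Z^d}|c_{\mathbf k}(f)|}<\varepsilon_1\quad\text{for every }\mathbf u\in U_{d_s}\setminus U,$$ and $\varepsilon_2>0$ with $\|f-\mathrm T_{d_s}f\|_{\mathrm L_\infty(\mathbb T^d)}/\|f\|_{\mathcal A^w(\mathbb T^d)}<\varepsilon_2$. Then $$\frac{\|f-\mathrm T_Uf\|_{\mathrm L_\infty(\mathbb T^d)}}{\|f\|_{\mathcal A^w(\mathbb T^d)}}\le\varepsilon_2+\sqrt{|U_{d_s}\setminus U|\,\varepsilon_1}.$$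
   Context: $\mathbb T=[0,1)$ with periodic identification; $c_{\mathbf k}(g)$ Fourier coefficients. $\mathcal A^w(\mathbb T^d)=\{g\in\mathrm L_1:\|g\|_{\mathcal A^w}=\sum_{\mathbf k}w(\mathbf k)|c_{\mathbf k}(g)|<\infty\}$. For $\mathbf u\subseteq\mathcal D$: $\mathrm P_{\mathbf u}f(\mathbf x_{\mathbf u})=\int_{\mathbb T^{|\mathcal D\setminus\mathbf u|}}f(\mathbf x)\,d\mathbf x_{\mathcal D\setminus\mathbf u}$, ANOVA terms $f_{\mathbf u}=\mathrm P_{\mathbf u}f-\sum_{\mathbf v\subsetneq\mathbf u}f_{\mathbf v}$ (recursively), $\mathbb F^{(d)}_{\mathbf u}=\{\mathbf k\in\mathbb Z^d:k_j=0\ \forall j\notin\mathbf u,\ k_j\neq0\ \forall j\in\mathbf u\}$. $U_{d_s}=\{\mathbf u\subseteq\mathcal D:|\mathbf u|\le d_s\}$. A subset of ANOVA terms is a $U\subseteq\mathcal P(\mathcal D)$ closed under taking subsets; $\mathrm T_Uf=\sum_{\mathbf u\in U}f_{\mathbf u}$, $\mathrm T_{d_s}=\mathrm T_{U_{d_s}}$. *)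

(* Defs.v *)
From HB Require Import structures.
From mathcomp Require Import all_boot all_order all_algebra.
From mathcomp Require Import all_classical all_reals all_analysis.
From mathcomp Require Import complex.
Set Implicit Arguments. Unset Strict Implicit. Unset Printing Implicit Defensive.
Import Order.TTheory GRing.Theory Num.Theory.
Import numFieldNormedType.Exports.
Local Open Scope classical_set_scope.
Local Open Scope ring_scope.

Section Torus.
Variables (R : realType) (d : nat).

(* Points of R^d (the torus T^d = [0,1)^d is the unit box below);
   coordinates are indexed by 'I_d, i.e. D = {1,..,d} is re-indexed as {0,..,d-1}. *)
Definition pt := d.-tuple R.
Definition freq := d.-tuple int.

Definition box01 : set pt := [set x | forall j : 'I_d, 0 <= tnth x j < 1].

Definition upd (x : pt) (i : 'I_d) (t : R) : pt :=
  [tuple (if j == i then t else tnth x j) | j < d].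

Definition cint1 (h : R -> R[i]) : R[i] :=
  (Rintegral (@lebesgue_measure R) `[0, 1[ (fun t => complex.Re (h t)) +i*
   Rintegral (@lebesgue_measure R) `[0, 1[ (fun t => complex.Im (h t)))%C.

Fixpoint intcoords (s : seq 'I_d) (g : pt -> R[i]) : pt -> R[i] :=
  match s with
  | [::] => g
  | i :: s' => fun x => cint1 (fun t => intcoords s' g (upd x i t))
  end.

Fixpoint eintcoords (s : seq 'I_d) (g : pt -> \bar R) : pt -> \bar R :=
  match s with
  | [::] => g
  | i :: s' => fun x =>
      (\int[@lebesgue_measure R]_(t in `[0%R, 1%R[) eintcoords s' g (upd x i t))%E
  end.

Definition L1 (f : pt -> R[i]) : Prop :=
  measurable_fun box01 (fun x => complex.Re (f x)) /\
  measurable_fun box01 (fun x => complex.Im (f x)) /\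
  (eintcoords (enum [set: 'I_d]) (fun x => (Normc.normc (f x))%:E)
     [tuple 0%R | _ < d] < +oo)%E.

Definition nullset (N : set pt) : Prop :=
  forall e : R, 0 < e -> exists a b : nat -> pt,
    (forall n j, tnth (a n) j <= tnth (b n) j) /\
    N `<=` \bigcup_n [set x | forall j, tnth (a n) j <= tnth x j <= tnth (b n) j] /\
    (forall m, \sum_(n < m) \prod_(j < d) (tnth (b n) j - tnth (a n) j) <= e).

Definition Linf (g : pt -> R[i]) : \bar R :=
  ereal_inf [set M : \bar R |
    nullset [set x | box01 x /\ (M < (Normc.normc (g x))%:E)%E]].

Definition expi2pi (th : R) : R[i] :=
  (cos (2 * pi * th) +i* sin (2 * pi * th))%C.

Definition kdot (k : freq) (x : pt) : R :=
  \sum_(j < d) (tnth k j)%:~R * tnth x j.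

Definition fcoef (g : pt -> R[i]) (k : freq) : R[i] :=
  intcoords (enum [set: 'I_d]) (fun x => g x * expi2pi (- kdot k x))
    [tuple 0%R | _ < d].

Definition Awnorm (w : freq -> R) (g : pt -> R[i]) : \bar R :=
  (\esum_(k in [set: freq]) (w k * Normc.normc (fcoef g k))%:E)%E.

Definition in_Aw (w : freq -> R) (g : pt -> R[i]) : Prop :=
  L1 g /\ (Awnorm w g < +oo)%E.

Definition abscoef_sum (g : pt -> R[i]) (K : set freq) : \bar R :=
  (\esum_(k in K) (Normc.normc (fcoef g k))%:E)%E.

Definition Ffreq (u : {set 'I_d}) : set freq :=
  [set k | (forall j, j \notin u -> tnth k j = 0) /\
           (forall j, j \in u -> tnth k j != 0)].

Definition Pu (u : {set 'I_d}) (f : pt -> R[i]) : pt -> R[i] :=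
  intcoords (enum (~: u)) f.

(* ANOVA terms f_u = P_u f - sum_{v proper subset of u} f_v, defined by
   recursion on a fuel argument (fuel #|u|.+1 suffices) *)
Fixpoint anova_aux (n : nat) (f : pt -> R[i]) (u : {set 'I_d}) : pt -> R[i] :=
  match n with
  | 0 => Pu u f
  | n'.+1 => fun x => Pu u f x - \sum_(v : {set 'I_d} | v \proper u) anova_aux n' f v x
  end.

Definition anova (f : pt -> R[i]) (u : {set 'I_d}) : pt -> R[i] :=
  anova_aux #|u|.+1 f u.

Definition Uds (ds : nat) : {set {set 'I_d}} := [set u : {set 'I_d} | (#|u| <= ds)%N].

(* a subset of ANOVA terms: closed under taking subsets *)
Definition downward_closed (U : {set {set 'I_d}}) : Prop :=
  forall u v : {set 'I_d}, u \in U -> v \subset u -> v \in U.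

Definition TU (U : {set {set 'I_d}}) (f : pt -> R[i]) : pt -> R[i] :=
  fun x => \sum_(u in U) anova f u x.

Definition Tds (ds : nat) (f : pt -> R[i]) : pt -> R[i] := TU (Uds ds) f.

End Torus.

(* Main.v *)
Require Import Defs.
From HB Require Import structures.
From mathcomp Require Import all_boot all_order all_algebra.
From mathcomp Require Import all_classical all_reals all_analysis.
From mathcomp Require Import complex.
From mathcomp Require Import measurable_realfun ring lra.
Set Implicit Arguments. Unset Strict Implicit. Unset Printing Implicit Defensive.
Import Order.TTheory GRing.Theory Num.Theory.
Import numFieldNormedType.Exports.
Local Open Scope classical_set_scope.
Local Open Scope ring_scope.

(** A function [h] in L1 of the torus with absolutely summable Fourier
    coefficients agrees almost everywhere with its Fourier series, hence is
    bounded almost everywhere by the sum of the absolute values of its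
    coefficients. The coefficients of the ANOVA term [f_u] are those of [f] at
    the frequencies with support [u], the others being zero; so [f_u] is bounded
    by [C_u], the sum of the [|c_k(f)|] over these [k]. By the triangle
    inequality the truncation error grows by at most the sum of [C_u] over the
    dropped [u]. Relative to the sum of all [|c_k(f)|] it is at most [1] and at
    most [t], the number of dropped terms times [eps1], hence at most [sqrt t].

    Integration over the torus is an abstract probability measure invariant
    under averaging over any one coordinate: this single property yields Fubini
    for the iterated integrals in any order. *)

(** * Coordinate updates *)

(** The definitions speak of iterated Lebesgue integrals and of covers by boxes, never of a measure
    on the torus, while the argument is an almost-everywhere one. Two bridges close this gap: a
    probability [P] on all of R^d, concentrated on the unit box, through which the iterated
    integrals are read, and the outer measure [boxext], which gives every [P]-null Borel subset of
    the box covers by boxes of arbitrarily small volume. The agreement of [h] with its series rests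
    on uniqueness: an integrable function whose coefficients all vanish is zero a.e. For this,
    trigonometric polynomials are made to converge boundedly, and pointwise on the box, to
    indicators of half-spaces; dominated convergence and a sigma-algebra argument then give zero
    integrals over all Borel sets, without a density theorem or a summation kernel. *)

Section Upd.
Variables (R : realType) (d : nat).
Implicit Types (x : pt R d) (i j : 'I_d).

Lemma tnth_upd x i t j : tnth (upd x i t) j = if j == i then t else tnth x j.
Proof. by rewrite tnth_mktuple. Qed.

Lemma upd_upd x i s t : upd (upd x i s) i t = upd x i t.
Proof. by apply: eq_from_tnth => j; rewrite !tnth_upd; case: eqP. Qed.

Lemma upd_comm x i j s t : i != j ->
  upd (upd x i s) j t = upd (upd x j t) i s.
Proof.
move=> ij; apply: eq_from_tnth => k; rewrite !tnth_upd.
by case: (eqVneq k j) => // ->; rewrite eq_sym (negbTE ij).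
Qed.

Lemma box01_upd x i t : box01 x -> 0 <= t < 1 -> box01 (upd x i t).
Proof. by move=> bx t01 j; rewrite tnth_upd; case: ifP => // _; exact: bx. Qed.

(** Overwriting the coordinates of [y] one after another by those of [x] turns [y] into [x]. *)
Lemma upd_invariant_const (T : Type) (g : pt R d -> T) :
  (forall i x t, g (upd x i t) = g x) -> forall x y, g x = g y.
Proof.
move=> gi x y.
pose z := foldr (fun i z => upd z i (tnth x i)) y (enum 'I_d).
have zE s : g (foldr (fun i z => upd z i (tnth x i)) y s) = g y.
  by elim: s => //= i s <-; rewrite gi.
rewrite -(zE (enum 'I_d)); congr g; apply: eq_from_tnth => j.
have : j \in enum 'I_d by rewrite mem_enum.
elim: (enum 'I_d) => //= i s ih; rewrite inE tnth_upd.
by case: eqP => [->//|_ /=]; exact: ih.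
Qed.

Lemma measurable_upd i :
  measurable_fun [set: pt R d * R] (fun z => upd z.1 i z.2 : pt R d).
Proof.
apply/measurable_fun_tnthP => j; rewrite /comp.
under eq_fun do rewrite tnth_upd.
case: (j == i); first exact: measurable_snd.
exact: (measurableT_comp (measurable_tnth j)).
Qed.

Lemma measurable_upd1 x i : measurable_fun [set: R] (fun t => upd x i t : pt R d).
Proof.
apply/measurable_fun_tnthP => j; rewrite /comp.
under eq_fun do rewrite tnth_upd.
by case: (j == i); [exact: measurable_id|exact: measurable_cst].
Qed.

Lemma measurable_box01 : measurable (@box01 R d).
Proof.
rewrite (_ :
  @box01 R d = \bigcap_(j in [set: 'I_d]) ((@tnth d R ^~ j) @^-1` `[0, 1[)); last first.
  apply/seteqP; split => x /= hx j; first by move=> _; have := hx j; rewrite /= in_itv.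
  by have := hx j I; rewrite /= in_itv.
apply: fin_bigcap_measurable => // j _.
rewrite -[X in measurable X]setTI; exact: measurable_tnth.
Qed.

End Upd.

(** * The uniform law on the unit interval *)

Section UniformIntegral.
Variable R : realType.

Let idTR : measurableTypeR R -> R := idfun.

#[local] HB.instance Definition _ :=
  @isMeasurableFun.Build _ _ (measurableTypeR R) R idTR (@measurable_id _ _ setT).

(** The uniform law is given on [measurableTypeR R]; its image under the identity is the same law on
    [R], the type of tuple entries. *)
Definition lam : probability R R := distribution (uniform_prob (@ltr01 R)) idTR.

Lemma integral_lam (h : R -> \bar R) : measurable_fun setT h ->
  (\int[lam]_t h t = \int[lebesgue_measure]_(t in `[0%R, 1%R[) h t)%E.
Proof.
move=> mh.
have key k : measurable_fun [set: R] k -> (forall x, 0 <= k x)%E ->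
    (\int[lam]_t k t = \int[lebesgue_measure]_(t in `[0%R, 1%R[) k t)%E.
  move=> mk k0; rewrite ge0_integral_distribution// integral_uniform//=.
  rewrite subr0 invr1 mul1e.
  (* [uniform_prob] integrates over the closed interval; the endpoint has measure zero. *)
  by rewrite integral_itv_bndo_bndc//; apply: measurable_funTS.
rewrite integralE [RHS]integralE key//; last exact: measurable_funepos.
by rewrite key//; exact: measurable_funeneg.
Qed.
End UniformIntegral.

(** * The uniform measure on the torus *)

Section InvariantMeasure.
Variables (R : realType) (d : nat).
Local Notation T := (pt R d).
Local Open Scope ereal_scope.

Definition avg (i : 'I_d) (g : T -> \bar R) : T -> \bar R :=
  fun x => \int[lam R]_t g (upd x i t).

Lemma measurable_updc (i : 'I_d) (g : T -> \bar R) : measurable_fun setT g ->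
  measurable_fun setT (fun z : T * R => g (upd z.1 i z.2)).
Proof. by move=> mg; apply: (measurableT_comp mg); exact: measurable_upd. Qed.

Lemma avg_ge0 i g : (forall x, 0 <= g x) -> forall x, 0 <= avg i g x.
Proof. by move=> g0 x; apply: integral_ge0. Qed.

Lemma measurable_avg i g : measurable_fun setT g -> (forall x, 0 <= g x) ->
  measurable_fun setT (avg i g).
Proof.
move=> mg g0.
exact: (@measurable_fun_fubini_tonelli_F _ _ T R R (lam R) _
  (measurable_updc i mg) (fun=> g0 _)).
Qed.

Lemma avg_avg i g : avg i (avg i g) = avg i g.
Proof.
apply/funext => x; rewrite /avg.
under eq_integral do under eq_integral do rewrite upd_upd.
transitivity (\int[lam R]_s (cst (avg i g x) s)); first by [].
by rewrite (integral_cst (lam R) measurableT (avg i g x)) [X in _ * X]probability_setT mule1.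
Qed.

Lemma avg_comm i j g : measurable_fun setT g -> (forall x, 0 <= g x) ->
  avg i (avg j g) = avg j (avg i g).
Proof.
move=> mg g0; have [->//|ij] := eqVneq i j.
apply/funext => x; rewrite /avg.
have mh : measurable_fun setT (fun z : R * R => g (upd (upd x i z.1) j z.2)).
  apply: (measurableT_comp (measurable_updc j mg)
     (g := fun z : R * R => (upd x i z.1 : T, z.2))).
  apply: measurable_fun_pair; last exact: measurable_snd.
  by apply: (measurableT_comp (measurable_upd1 x i)); exact: measurable_fst.
rewrite (@fubini_tonelli _ _ _ _ _ (lam R) (lam R) _ mh (fun=> g0 _))/=.
by apply: eq_integral => t _; apply: eq_integral => s _; rewrite upd_comm.
Qed.

(** Restricted to nonnegative integrands, where Tonelli needs no integrability; signed integrands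
    follow in [integral_avg]. *)
Definition invariant (P : probability T R) := forall i (g : T -> \bar R),
  measurable_fun setT g -> (forall x, 0 <= g x) ->
  \int[P]_x g x = \int[P]_x avg i g x.

(** Start from the Dirac mass at the origin and redraw the coordinates one at a time uniformly.
    Redrawing [j] creates invariance along [j], since averaging is idempotent, and keeps the earlier
    invariances, since averages along different coordinates commute. *)
Lemma exists_invariant : exists P : probability T R, invariant P.
Proof.
suff [P hP] : exists P : probability T R, forall i, i \in enum 'I_d ->
    forall g, measurable_fun setT g -> (forall x, 0 <= g x) ->
    \int[P]_x g x = \int[P]_x avg i g x.
  by exists P => i; apply: hP; rewrite mem_enum.
elim: (enum 'I_d) => [|j s [P hP]].
  by exists (dirac ([tuple 0%R | _ < d] : T)).
pose X := mfun_Sub (mem_set (@measurable_upd R d j) : _ \in mfun).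
pose Q : probability T R := distribution (P \x lam R) X.
have QE g : measurable_fun setT g -> (forall x, 0 <= g x) ->
    \int[Q]_x g x = \int[P]_x avg j g x.
  move=> mg g0; rewrite ge0_integral_distribution//.
  exact: (@fubini_tonelli1 _ _ T R R P (lam R) _ (measurable_updc j mg) (fun=> g0 _)).
exists Q => i si g mg g0.
have mag k : measurable_fun setT (avg k g) by apply: (@measurable_avg k g).
have ag0 k : forall x, 0 <= avg k g x by apply: avg_ge0.
rewrite (QE _ mg g0) (QE _ (mag i) (ag0 i)).
move: si; rewrite inE => /orP[/eqP ->|si]; first by rewrite avg_avg.
by rewrite (avg_comm j i mg g0) -(hP _ si _ (mag j) (ag0 j)).
Qed.

End InvariantMeasure.

(** * Iterated partial integrals *)

Section PartialIntegral.
Variables (R : realType) (d : nat) (P : probability (pt R d) R).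
Hypothesis invP : invariant P.
Local Notation T := (pt R d).
Local Notation intble g := (P.-integrable [set: T] (EFin \o g)).
Implicit Types (g h : T -> R) (i : 'I_d) (x : T).

Definition rint1 i g : T -> R := fun x =>
  Rintegral (@lebesgue_measure R) `[0, 1[ (fun t => g (upd x i t)).

Lemma rint1_avg i g x : measurable_fun [set: T] g ->
  rint1 i g x = fine (avg i (EFin \o g) x).
Proof.
move=> mg; rewrite /rint1 /avg integral_lam//.
apply/measurable_EFinP; apply: (measurableT_comp mg); exact: measurable_upd1.
Qed.

Lemma integrable_measurable g : intble g -> measurable_fun [set: T] g.
Proof. by move=> ig; apply/measurable_EFinP; exact: measurable_int ig. Qed.

Lemma integrable_upd i g : intble g ->
  (P \x lam R)%E.-integrable [set: T * R] (fun z => (g (upd z.1 i z.2))%:E).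
Proof.
move=> ig; have mg := integrable_measurable ig.
have mgu := @measurable_updc R d i (EFin \o g) (measurable_int _ ig).
apply/integrable12ltyP => //.
have /integrableP[_] := ig.
rewrite (invP i (g := fun x => `|(EFin \o g) x|%E))//.
by apply: measurableT_comp => //; exact: measurable_int ig.
Qed.

Lemma integrable_avg i g : intble g -> P.-integrable [set: T] (avg i (EFin \o g)).
Proof. by move=> ig; exact: (integrable_fubini_F (integrable_upd i ig)). Qed.

(** Invariance is available for nonnegative integrands; it is applied to the positive and the
    negative part, which commute with composition by [upd]. *)
Lemma integral_avg i g : intble g ->
  (\int[P]_x avg i (EFin \o g) x = \int[P]_x (g x)%:E)%E.
Proof.
move=> ig; have mg := measurable_int _ ig.
transitivity (\int[(P \x lam R)%E]_z (g (upd z.1 i z.2))%:E)%E.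
  exact: (integral12_prod_meas1 (integrable_upd i ig)).
have tonelli (k : T -> \bar R) : measurable_fun [set: T] k -> (forall x, 0 <= k x)%E ->
    (\int[(P \x lam R)%E]_z k (upd z.1 i z.2) = \int[P]_x k x)%E.
  move=> mk k0; rewrite (invP i mk k0).
  exact: (@fubini_tonelli1 _ _ T R R P (lam R) _ (measurable_updc i mk) (fun=> k0 _)).
rewrite integralE [RHS]integralE; congr (_ - _)%E.
- rewrite -(tonelli _ (measurable_funepos mg) (funepos_ge0 _)); apply: eq_integral => z _.
  exact: (congr1 (fun k => k z) (funepos_comp (EFin \o g) (fun z : T * R =>
    upd z.1 i z.2))).
- rewrite -(tonelli _ (measurable_funeneg mg) (funeneg_ge0 _)); apply: eq_integral => z _.
  exact: (congr1 (fun k => k z) (funeneg_comp (EFin \o g) (fun z : T * R =>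
    upd z.1 i z.2))).
Qed.

(** [fine] sends an infinite average to 0, so the two sides differ where the average is infinite; by
    integrability this is a null set. *)
Lemma ae_rint1 i g : intble g ->
  ae_eq P [set: T] (EFin \o rint1 i g) (avg i (EFin \o g)).
Proof.
move=> ig; have mg := integrable_measurable ig.
have := integrable_ae measurableT (integrable_avg i ig).
by apply: filterS => x /= /(_ Logic.I) fx _; rewrite rint1_avg// fineK.
Qed.

Lemma measurable_rint1 i g : intble g -> measurable_fun [set: T] (rint1 i g).
Proof.
move=> ig; have mg := integrable_measurable ig.
rewrite (_ : rint1 i g = fine \o avg i (EFin \o g)).
  apply: (measurableT_comp (fine_measurable (D := [set: \bar R]) _)) => //.
  exact: measurable_int (integrable_avg i ig).
by apply/funext => x; rewrite rint1_avg.
Qed.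

Lemma integrable_rint1 i g : intble g -> intble (rint1 i g).
Proof.
move=> ig; have mRI := (measurable_EFinP _ _).2 (measurable_rint1 i ig).
have /integrableP[mA iA] := integrable_avg i ig.
apply/integrableP; split => //; apply: le_lt_trans iA.
rewrite le_eqVlt; apply/orP; left; apply/eqP.
apply: ae_eq_integral => //; [exact: measurableT_comp|exact: measurableT_comp|].
by apply: filterS (ae_rint1 i ig) => x xE ?; rewrite xE.
Qed.

Lemma Rintegral_rint1 i g : intble g ->
  \int[P]_x rint1 i g x = \int[P]_x g x.
Proof.
move=> ig; congr fine; rewrite -(integral_avg i ig).
apply: ae_eq_integral => //; last exact: ae_rint1.
  exact: (measurable_EFinP _ _).2 (measurable_rint1 i ig).
exact: measurable_int (integrable_avg i ig).
Qed.

Definition rint (s : seq 'I_d) g := foldr rint1 g s.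

Lemma integrable_rint s g : intble g -> intble (rint s g).
Proof. by move=> ig; elim: s => //= i s ih; exact: integrable_rint1. Qed.

Lemma Rintegral_rint s g : intble g -> \int[P]_x rint s g x = \int[P]_x g x.
Proof.
move=> ig; elim: s => //= i s ih.
by rewrite Rintegral_rint1//; exact: integrable_rint.
Qed.

Lemma rint1_upd i g x t : rint1 i g (upd x i t) = rint1 i g x.
Proof. by apply: eq_Rintegral => s _; rewrite upd_upd. Qed.

Lemma rint_upd i s g x t : i \in s -> rint s g (upd x i t) = rint s g x.
Proof.
elim: s x => //= j s ih x; rewrite inE; case: (eqVneq i j) => [-> _|ij /= si].
  exact: rint1_upd.
by apply: eq_Rintegral => u _; rewrite (upd_comm _ _ _ ij) ih.
Qed.

(** The full iterated integral ignores every coordinate of its base point, hence is constant and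
    equal to its own mean, which invariance identifies with the mean of [g]. The equality thus holds
    at every base point. *)
Lemma rint_full g x : intble g -> rint (enum [set: 'I_d]) g x = \int[P]_y g y.
Proof.
move=> ig; rewrite -(Rintegral_rint (enum [set: 'I_d]) ig).
under [RHS]eq_Rintegral => y _.
  rewrite (@upd_invariant_const R d _ (rint (enum [set: 'I_d]) g) _ y x); last first.
    by move=> i z t; rewrite rint_upd// mem_enum in_setT.
  over.
by rewrite Rintegral_cst//= (probability_setT P) mulr1.
Qed.

End PartialIntegral.

(** * Boxes and the Borel sets *)

Section Cylinders.
Variable R : realType.

Lemma lamE (A : set R) : measurable A ->
  (lam R A = lebesgue_measure (A `&` `[0%R, 1%R[))%E.
Proof.
move=> mA; have -> : lam R A = (\int[lam R]_t (\1_A t)%:E)%E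
  by rewrite integral_indic// setIT.
rewrite integral_lam; last exact/measurable_EFinP/measurable_indic.
by rewrite integral_indic.
Qed.

Lemma lam_unit : lam R `[0%R, 1%R[%classic = 1%E.
Proof.
by rewrite lamE// setIid lebesgue_measure_itv/= lte_fin ltr01 oppr0 adde0.
Qed.

Lemma lam_itv_le (a b : R) : a <= b -> (lam R `[a, b]%classic <= (b - a)%:E)%E.
Proof.
move=> ab; rewrite lamE//.
apply: (@le_trans _ _ (lebesgue_measure (`[a, b] : set R))).
  by apply: le_measure; rewrite ?inE//; exact: measurableI.
rewrite lebesgue_measure_itv/= lte_fin; case: ifPn => // _.
by rewrite lee_fin subr_ge0.
Qed.

Variables (d : nat) (P : probability (pt R d) R).
Hypothesis invP : invariant P.

Lemma cylinderE (s : seq 'I_d) (A : 'I_d -> set R) :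
  [set x : pt R d | forall j, j \in s -> A j (tnth x j)] =
  \bigcap_(j in [set j | j \in s]) ((@tnth d R ^~ j) @^-1` A j).
Proof. by []. Qed.

Lemma measurable_cylinder (s : seq 'I_d) (A : 'I_d -> set R) :
  (forall j, measurable (A j)) ->
  measurable [set x : pt R d | forall j, j \in s -> A j (tnth x j)].
Proof.
move=> mA; rewrite cylinderE; apply: fin_bigcap_measurable => // j _.
by rewrite -[X in measurable X]setTI; exact: measurable_tnth.
Qed.

(** Averaging the indicator of the cylinder over [i] splits off the factor [lam R (A i)], because
    the remaining constraints do not involve [i]. *)
Lemma cylinder_measure (s : seq 'I_d) (A : 'I_d -> set R) (l : 'I_d -> R) :
  uniq s -> (forall j, measurable (A j)) -> (forall j, lam R (A j) = (l j)%:E) ->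
  P [set x | forall j, j \in s -> A j (tnth x j)] = (\prod_(j <- s) l j)%:E.
Proof.
move=> us mA lA; elim: s us => [_|i s ih /= /andP[si us]].
  rewrite big_nil (_ : [set _ | _] = setT) ?(probability_setT P)//.
  by apply/seteqP; split.
rewrite big_cons.
set E := [set x | _]; set F := [set x : pt R d | forall j, j \in s -> A j (tnth x j)].
have mE : measurable E by exact: measurable_cylinder.
have mF : measurable F by exact: measurable_cylinder.
have -> : P E = (\int[P]_x (\1_E x)%:E)%E by rewrite integral_indic// setIT.
rewrite (invP i); last 2 first.
- exact/measurable_EFinP/measurable_indic.
- by move=> x; rewrite lee_fin.
transitivity (\int[P]_x ((l i)%:E * (\1_F x)%:E))%E; last first.
  rewrite integralZl//; last exact: integrable_indic.
  have PF : P F = (\prod_(j <- s) l j)%:E := ih us.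
  by rewrite (integral_indic P measurableT mF) setIT EFinM -PF.
apply: eq_integral => x _; rewrite /avg.
under eq_integral => t _.
  rewrite (_ : (\1_E (upd x i t))%:E = ((\1_F x)%:E * (\1_(A i) t)%:E)%E); last first.
    rewrite -EFinM; congr EFin; rewrite !indicE -natrM mulnb; congr (_%:R).
    congr nat_of_bool; apply/idP/andP => [|[]]; rewrite !inE.
      move=> h; split.
        move=> j sj; have := h j; rewrite inE sj orbT tnth_upd => /(_ isT).
        by case: eqP => // ji; move: si; rewrite -ji sj.
      by have := h i; rewrite inE eqxx tnth_upd eqxx => /(_ isT).
    move=> hF hA j; rewrite inE tnth_upd; case: eqP => [-> //|_ /=].
    exact: hF.
  over.
rewrite integralZl//; last exact: integrable_indic.
by rewrite (integral_indic (lam R) measurableT (mA i)) setIT muleC -lA.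
Qed.

Lemma probability_box01 : P (@box01 R d) = 1%E.
Proof.
have := @cylinder_measure (enum 'I_d) (fun=> `[0%R, 1%R[%classic) (fun=> 1)
  (enum_uniq _) (fun=> measurable_itv _) (fun=> lam_unit).
rewrite big1// => <-; congr (P _); apply/seteqP; split => x /= hx j.
  by move=> _; have := hx j; rewrite in_itv.
by have := hx j; rewrite mem_enum in_itv => /(_ isT).
Qed.

(** Only an inequality: [lam] sees just the part of each side that lies in the unit interval. *)
Lemma probability_closed_box (a b : pt R d) :
  (forall j, tnth a j <= tnth b j) ->
  (P [set x | forall j, (tnth a j <= tnth x j <= tnth b j)%R] <=
   (\prod_(j < d) (tnth b j - tnth a j))%:E)%E.
Proof.
move=> ab.
have finl j :
  lam R `[tnth a j, tnth b j]%classic = (fine (lam R `[tnth a j, tnth b j]%classic))%:E.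
  rewrite fineK// ge0_fin_numE//.
  exact: le_lt_trans (probability_le1 (lam R) (measurable_itv _)) (ltry _).
have := @cylinder_measure (enum 'I_d) (fun j => `[tnth a j, tnth b j]%classic) _
  (enum_uniq _) (fun=> measurable_itv _) finl.
rewrite big_enum/= (_ :
  [set _ | _] = [set x | forall j, (tnth a j <= tnth x j <= tnth b j)%R]).
  move=> ->; rewrite lee_fin; apply: ler_prod => j _; apply/andP; split.
    exact: fine_ge0.
  by rewrite -lee_fin -finl; exact: lam_itv_le.
apply/seteqP; split => x /= hx j; last by move=> _; have := hx j; rewrite in_itv.
by have := hx j; rewrite mem_enum in_itv => /(_ isT).
Qed.

End Cylinders.

(** * Generation of the Borel sets by half-spaces *)

Section TupleMeasurable.
Variables (R : realType) (d : nat).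

Lemma measurable_le_tnth (j : 'I_d) (a : R) :
  measurable [set x : pt R d | tnth x j <= a].
Proof.
rewrite (_ : [set _ | _] = [set: pt R d] `&` (@tnth d R ^~ j) @^-1` `]-oo, a]).
  exact: measurable_tnth.
by apply/seteqP; split => x /=; rewrite in_itv/=; tauto.
Qed.

(** Serves twice, with the Carathéodory measurable sets and with [annih_set] as [S]; in both cases
    only half-spaces remain to be treated by hand. *)
Lemma measurable_pt_ind (S : set (set (pt R d))) :
  sigma_algebra [set: pt R d] S ->
  (forall j a, S [set x | tnth x j <= a]) ->
  forall E, measurable E -> S E.
Proof.
move=> sS hS; apply: smallest_sub => //.
rewrite -bigcup_seq => B [j /= _ [A mA <-]].
have [S0 SC SU] := sS.
pose G := [set A : set R | S ([set: pt R d] `&` (@tnth d R ^~ j) @^-1` A)].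
have sC X : S X -> S (~` X) by move=> /SC; rewrite setTD.
suff : @measurable _ R `<=` G by apply.
apply: smallest_sub.
  split => [|X|F] /=; rewrite /G/= !setTI.
  - by rewrite preimage_set0.
  - by rewrite setTD preimage_setC; exact: sC.
  - move=> hF; rewrite preimage_bigcup; apply: SU => n.
    by have := hF n; rewrite setTI.
move=> _ [[a b] _ <-]; rewrite /G/= setTI.
(* The interval is expressed through half-lines by complements and one union, the operations under
   which [S] is closed. *)
rewrite (_ : _ @^-1` _ =
    ~` (~` [set x : pt R d | tnth x j <= b] `|` [set x | tnth x j <= a])).
  apply: (sC); rewrite -bigcup2E; apply: SU => -[|[|n]] /=; first exact: sC.
    exact: hS.
  exact: S0.
apply/seteqP; split => x /=; rewrite in_itv/= => h.
  by move=> [|] h'; move: h => /andP[]; [move=> _ /h'|rewrite ltNge h'].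
apply/andP; split; first by rewrite ltNge; apply/negP => ?; apply: h; right.
by apply: contrapT => ?; apply: h; left.
Qed.
End TupleMeasurable.

(** * Null sets in the sense of covers by boxes *)

Section NullSets.
Variables (R : realType) (d : nat).
Hypothesis d_gt0 : (0 < d)%N.
Local Notation T := (pt R d).
Local Open Scope ereal_scope.

Definition cbox (a b : T) : set T :=
  [set x | forall j, (tnth a j <= tnth x j <= tnth b j)%R].
Definition vol (a b : T) : R := (\prod_(j < d) (tnth b j - tnth a j))%R.
Definition boxle (a b : T) := forall j, (tnth a j <= tnth b j)%R.

Lemma vol_ge0 a b : boxle a b -> (0 <= vol a b)%R.
Proof. by move=> ab; apply: prodr_ge0 => j _; rewrite subr_ge0; exact: ab. Qed.

Lemma measurable_cbox a b : measurable (cbox a b).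
Proof.
rewrite (_ : cbox a b = \bigcap_(j in [set: 'I_d])
    ((@tnth d R ^~ j) @^-1` `[tnth a j, tnth b j])).
  apply: fin_bigcap_measurable => // j _.
  by rewrite -[X in measurable X]setTI; exact: measurable_tnth.
apply/seteqP; split => x /= hx j; first by move=> _; have := hx j; rewrite /= in_itv.
by have := hx j Logic.I; rewrite /= in_itv.
Qed.

(* The case distinction makes [boxwt set0 = 0] hold also for [d = 0]. *)
Definition boxwt (B : set T) : \bar R :=
  if `[< B = set0 >] then 0 else
  ereal_inf [set (vol p.1 p.2)%:E | p in [set p : T * T | boxle p.1 p.2 /\
    B `<=` cbox p.1 p.2]].

Lemma boxwt0 : boxwt set0 = 0.
Proof. by rewrite /boxwt asboolT. Qed.

Lemma boxwt_ge0 B : 0 <= boxwt B.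
Proof.
rewrite /boxwt; case: ifPn => // _.
by apply: le_ereal_inf_tmp => _ [p [ab _] <-]; rewrite lee_fin vol_ge0.
Qed.

Lemma boxwt_le a b B : boxle a b -> B `<=` cbox a b -> boxwt B <= (vol a b)%:E.
Proof.
move=> ab Bab; rewrite /boxwt; case: ifPn => _; first by rewrite lee_fin vol_ge0.
by apply: ereal_inf_lbound; exists (a, b).
Qed.

Lemma boxwt_adherent B (e : R) : (0 < e)%R -> boxwt B < +oo ->
  exists p : T * T, [/\ boxle p.1 p.2, B `<=` cbox p.1 p.2 &
    (vol p.1 p.2)%:E <= boxwt B + e%:E].
Proof.
move=> e0; have := boxwt_ge0 B; rewrite /boxwt; case: ifPn => [/asboolP ->|B0 w0 wy].
  (* As [d > 0], a box reduced to a point has volume 0; for [d = 0] the empty product would be 1. *)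
  move=> _ _; pose z : T := [tuple 0%R | _ < d]; exists (z, z); split => //=.
  rewrite add0e lee_fin /vol (bigD1 (Ordinal d_gt0))//= subrr mul0r; exact: ltW.
have /(lb_ereal_inf_adherent e0)[_ [p [ab Bab] <-] /ltW pe] :
    ereal_inf [set (vol p.1 p.2)%:E | p in [set p : T * T | boxle p.1 p.2 /\
    B `<=` cbox p.1 p.2]] \is a fin_num by rewrite ge0_fin_numE.
by exists p.
Qed.

(** [mu_ext] takes covers by Borel sets, each weighed by its cheapest enclosing box; up to an
    arbitrarily small error this amounts to covers by boxes. A set contained in no box weighs
    [+oo]. *)
Definition boxext : set T -> \bar R := mu_ext boxwt.

HB.instance Definition _ := isOuterMeasure.Build R T boxext
  (mu_ext0 boxwt0 boxwt_ge0) (mu_ext_ge0 boxwt_ge0) (le_mu_ext boxwt)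
  (mu_ext_sigma_subadditive boxwt_ge0).

Lemma boxext_le (A : (set T)^nat) X : (forall k, measurable (A k)) ->
  X `<=` \bigcup_k A k -> boxext X <= \sum_(k <oo) boxwt (A k).
Proof. by move=> mA XA; apply: ereal_inf_lbound; exists A. Qed.

(** A hyperplane cuts an enclosing box into two boxes whose volumes add up to the original one. This
    is what makes half-spaces Carathéodory measurable. *)
Lemma boxwt_split (B : set T) (j : 'I_d) (c : R) :
  boxwt (B `&` [set x | (tnth x j <= c)%R]) +
  boxwt (B `&` ~` [set x | (tnth x j <= c)%R]) <= boxwt B.
Proof.
have [->|B0] := eqVneq B set0; first by rewrite !set0I !boxwt0 adde0.
rewrite {3}/boxwt asboolF; last exact/eqP.
apply: le_ereal_inf_tmp => _ [[a b] /= [ab Bab] <-].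
(* [m] is [c] clamped to the side of the box, so both pieces have ordered corners even when the
   hyperplane misses the box. *)
pose m := Num.max (tnth a j) (Num.min (tnth b j) c).
have am : (tnth a j <= m)%R by rewrite le_max lexx.
have mb : (m <= tnth b j)%R by rewrite ge_max ab ge_min lexx.
have abl : boxle a (upd b j m).
  by move=> i; rewrite tnth_upd; case: eqP => [->|_]; [|exact: ab].
have abr : boxle (upd a j m) b.
  by move=> i; rewrite tnth_upd; case: eqP => [->|_]; [|exact: ab].
apply: le_trans (leeD (boxwt_le abl _) (boxwt_le abr _)) _.
- move=> x [/Bab xab /= xc] i; rewrite tnth_upd; case: eqP => [->|_]; last exact: xab.
  have /andP[-> xb] := xab j.
  by rewrite /m le_max le_min xb xc orbT.
- move=> x [/Bab xab /= /negP]; rewrite -ltNge => xc i; rewrite tnth_upd.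
  case: eqP => [->|_]; last exact: xab.
  have /andP[ax ->] := xab j.
  by rewrite /m ge_max ax ge_min (ltW xc) orbT.
rewrite -EFinD lee_fin /vol (bigD1 j)//= [X in (_ + X)%R](bigD1 j)//=.
rewrite [X in (_ <= X)%R](bigD1 j)//= !tnth_upd eqxx.
set p := (\prod_(i < d | i != j) _)%R.
set q := (\prod_(i < d | i != j) _)%R; set r := (\prod_(i < d | i != j) _)%R.
have -> : p = r by apply: eq_bigr => i /negbTE ij; rewrite !tnth_upd ij.
have -> : q = r by apply: eq_bigr => i /negbTE ij; rewrite !tnth_upd ij.
by rewrite -mulrDl addrC subrKA.
Qed.

Lemma caratheodory_half (j : 'I_d) (c : R) :
  boxext.-caratheodory [set x | (tnth x j <= c)%R].
Proof.
apply: le_caratheodory_measurable => X.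
apply: le_ereal_inf_tmp => _ [A [mA XA] <-].
have mH := @measurable_le_tnth R d j c.
set H := [set x | _] in mH *.
apply: (@le_trans _ _ (\sum_(k <oo) boxwt (A k `&` H) + \sum_(k <oo) boxwt (A k `&` ~` H))).
  apply: leeD; apply: boxext_le => [k|].
  - exact: measurableI.
  - by rewrite -setI_bigcupl; exact: setSI.
  - by apply: measurableI => //; exact: measurableC.
  - by rewrite -setI_bigcupl; exact: setSI.
rewrite -nneseriesD//; [|by move=> *; exact: boxwt_ge0|by move=> *; exact: boxwt_ge0].
apply: lee_nneseries => k *; last exact: boxwt_split.
by rewrite adde_ge0// boxwt_ge0.
Qed.

Lemma caratheodory_measurable (E : set T) : measurable E -> boxext.-caratheodory E.
Proof.
apply: measurable_pt_ind; last exact: caratheodory_half.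
split.
- exact: caratheodory_measurable_set0.
- by move=> A cA; rewrite setTD; exact: caratheodory_measurable_setC.
- by move=> A cA; exact: caratheodory_measurable_bigcup.
Qed.

Lemma boxext_box01 : boxext (@box01 R d) <= 1.
Proof.
pose A k := if k == 0%N then @box01 R d else set0.
apply: (le_trans (@boxext_le A _ _ _)).
- by case => [|k] /=; [exact: measurable_box01|exact: measurable0].
- by move=> x bx; exists 0%N.
rewrite (nneseries_split 0%N 1%N); last by move=> *; exact: boxwt_ge0.
rewrite add0n big_nat1 eseries0 ?adde0; last first.
  by case => // k _ _; rewrite /A/= boxwt0.
have := @boxwt_le [tuple 0%R | _ < d] [tuple 1%R | _ < d] (@box01 R d).
rewrite /vol big1; last by move=> i _; rewrite !tnth_mktuple subr0.
apply; first by move=> j; rewrite !tnth_mktuple ler01.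
by move=> x bx j; rewrite !tnth_mktuple; have /andP[-> /ltW ->] := bx j.
Qed.

(** Going back from the outer measure to boxes, half of [e] pays for a cover by Borel sets and the
    other half, split geometrically, for enclosing each of them in a box. *)
Lemma nullset_boxext (N : set T) : nullset N <-> boxext N = 0.
Proof.
split => [nN|N0 e e0].
  apply/eqP; rewrite eq_le outer_measure_ge0 andbT.
  apply/lee_addgt0Pr => e e0; rewrite add0e.
  have [a [b [ab [Nab vab]]]] := nN e e0.
  apply: (le_trans (@boxext_le (fun k => cbox (a k) (b k)) _ _ Nab)).
    by move=> k; exact: measurable_cbox.
  apply: lime_le; first by apply: is_cvg_nneseries => k _ _; exact: boxwt_ge0.
  near=> m; apply: (@le_trans _ _ (\sum_(k < m) (vol (a k) (b k))%:E)).
    rewrite big_mkord; apply: lee_sum => k _; exact: boxwt_le.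
  by rewrite sumEFin lee_fin; exact: vab.
have e20 : (0 < e / 2)%R by rewrite divr_gt0.
have /(lb_ereal_inf_adherent e20) : boxext N \is a fin_num by rewrite N0.
have N0' : ereal_inf [set \sum_(k <oo) boxwt (A k) | A in measurable_cover N] = 0 by [].
rewrite N0' add0e => -[_ [A [mA NA] <-] Ae].
have wy k : boxwt (A k) < +oo.
  apply: le_lt_trans (lt_trans Ae (ltry _)).
  rewrite (nneseries_split 0%N k.+1); last by move=> *; exact: boxwt_ge0.
  rewrite add0n big_nat_recr//= -addeA addeC -addeA leeDl// adde_ge0//.
    by apply: nneseries_ge0 => *; exact: boxwt_ge0.
  by apply: sume_ge0 => *; exact: boxwt_ge0.
have ek0 k : (0 < (e / 2) / (2 ^ k.+1)%:R)%R by rewrite divr_gt0// ltr0n expn_gt0.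
have [p hp] := choice (fun k => boxwt_adherent (ek0 k) (wy k)).
exists (fun k => (p k).1), (fun k => (p k).2); split; first by move=> n; have [] := hp n.
split; first by move=> x /NA[k _ Akx]; exists k => //; have [_ + _] := hp k; exact.
move=> m; rewrite -lee_fin -sumEFin.
apply: (@le_trans _ _ (\sum_(k <oo) (boxwt (A k) + ((e / 2) / (2 ^ k.+1)%:R)%:E))).
  apply: (@le_trans _ _ (\sum_(0 <= k < m) (boxwt (A k) + ((e / 2) / (2 ^ k.+1)%:R)%:E))).
    by rewrite big_mkord; apply: lee_sum => k _; have [] := hp k.
  apply: nneseries_lim_ge => k _ _.
  by rewrite adde_ge0 ?boxwt_ge0// lee_fin ltW.
apply: (le_trans (epsilon_trick xpredT (fun k => boxwt_ge0 (A k)) (ltW e20))).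
rewrite [e in leRHS]splitr EFinD leeD2r//; exact: ltW.
Unshelve. all: by end_near. Qed.

Lemma nullset_sub (M N : set T) : M `<=` N -> nullset N -> nullset M.
Proof.
move=> MN /nullset_boxext N0; apply/nullset_boxext/eqP.
by rewrite eq_le outer_measure_ge0 andbT -N0; exact: le_outer_measure.
Qed.

Lemma nullsetU (M N : set T) : nullset M -> nullset N -> nullset (M `|` N).
Proof.
move=> /nullset_boxext M0 /nullset_boxext N0; apply/nullset_boxext/eqP.
rewrite eq_le outer_measure_ge0 andbT.
have : boxext (M `|` N) <= boxext M + boxext N by exact: outer_measureU2.
by rewrite M0 N0 adde0.
Qed.

Variable P : probability T R.
Hypothesis invP : invariant P.

Lemma le_boxwt B : measurable B -> P B <= boxwt B.
Proof.
move=> mB; rewrite /boxwt; case: ifPn => [/asboolP ->|_]; first by rewrite measure0.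
apply: le_ereal_inf_tmp => _ [[a b] /= [ab Bab] <-].
apply: le_trans (probability_closed_box invP ab).
by apply: le_measure; rewrite ?inE//; exact: measurable_cbox.
Qed.

Lemma le_boxext E : measurable E -> P E <= boxext E.
Proof.
move=> mE; apply: le_ereal_inf_tmp => _ [A [mA EA] <-].
apply: (@le_trans _ _ (\sum_(k <oo) P (A k))).
  apply: measure_sigma_subadditive => //.
by apply: lee_nneseries => k *; [exact: measure_ge0|exact: le_boxwt].
Qed.

(* As [boxext] is additive on Borel sets, dominates [P] and gives the unit box
   mass at most 1 = P (box01), it coincides with [P] on Borel subsets of it. *)
Lemma nullset_probability0 E : measurable E -> E `<=` @box01 R d -> P E = 0 ->
  nullset E.
Proof.
move=> mE Eb PE0; apply/nullset_boxext/eqP.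
rewrite eq_le outer_measure_ge0 andbT.
have mb := @measurable_box01 R d.
have := caratheodory_measurable mE (@box01 R d).
rewrite setIidr// => bE.
have h1 : 1 <= boxext (@box01 R d `&` ~` E).
  have mbE : measurable (@box01 R d `&` ~` E).
    by apply: measurableI => //; exact: measurableC.
  apply: le_trans (le_boxext mbE).
  have Pb := probability_box01 invP.
  have Pby : P (@box01 R d) < +oo by rewrite Pb ltry.
  apply: (@le_trans _ _ (P (@box01 R d) - P E)); first by rewrite Pb PE0 sube0.
  by rewrite -setDE (measureD mb mE Pby) setIidr.
have : boxext E + 1 <= 0 + 1.
  rewrite add0e; apply: le_trans boxext_box01; rewrite bE; exact: leeD2l.
by rewrite leeD2rE.
Qed.

End NullSets.

(** * Trigonometric coefficients *)

Section TrigIntegral.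
Variable R : realType.

Lemma sin_periodz (x : R) (n : int) : sin (x + n%:~R * (2 * pi)) = sin x.
Proof.
have key (m : nat) y : sin (y + m%:R * (2 * pi)) = sin (y : R).
  rewrite !mulr_natl; exact: (periodicn (@sinD2pi R)).
case: n => m; first exact: key.
rewrite NegzE mulrNz mulNr -[in RHS](subrK (m.+1%:R * (2 * pi)) x).
by rewrite key.
Qed.

(** The shift [c] absorbs the contribution of the other coordinates, and a further shift by
    [- pi / 2] turns the sine into the same case. *)
Lemma Rintegral_cos_period (n : int) (c : R) : n != 0 ->
  Rintegral (@lebesgue_measure R) `[0, 1[
    (fun t => cos (2 * pi * (n%:~R * t) + c)) = 0.
Proof.
move=> n0; pose a : R := 2 * pi * n%:~R.
have a0 : a != 0 by rewrite mulf_neq0 ?intr_eq0// mulf_neq0 ?pnatr_eq0// gt_eqF ?pi_gt0.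
pose f t : R := cos (a * t + c); pose F t : R := a^-1 * sin (a * t + c).
have dF (t : R) : is_derive t (1 : R) F (f t).
  rewrite /F /f; apply: is_derive_eq.
  by rewrite addr0 /GRing.scale/= mulr1 mulrCA mulVf// mulr1.
have cf : continuous f.
  move=> t; apply: (@continuous_comp _ _ _ (fun t => a * t + c) cos).
    by apply: cvgD; [apply: cvgM; [exact: cvg_cst|exact: cvg_id]|exact: cvg_cst].
  exact: continuous_cos.
have cF t : {for t, continuous F}.
  exact/differentiable_continuous/derivable1_diffP/ex_derive.
under eq_Rintegral => t _ do rewrite mulrA -/a.
rewrite Rintegral_itv_bndo_bndc; last first.
  apply: (@integrableS _ (measurableTypeR R) R lebesgue_measure `[0, 1]%classic) => //.
    by apply: subset_itvl; rewrite bnd_simp.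
  apply: continuous_compact_integrable; first exact: segment_compact.
  exact: continuous_subspaceT.
rewrite /Rintegral (@continuous_FTC2 _ f F) ?ltr01//=.
- rewrite /F mulr0 add0r mulr1 (_ : a + c = c + n%:~R * (2 * pi)); last
  by rewrite /a; ring.
  by rewrite sin_periodz subrr.
- exact: continuous_subspaceT.
- by split=> [t _| |];
  [exact: ex_derive|exact/cvg_at_right_filter/cF|exact/cvg_at_left_filter/cF].
- by move=> t _; rewrite derive1E; exact: derive_val.
Qed.
End TrigIntegral.

(** * Real harmonics and their behaviour under partial integration *)

Section TrigCoef.
Variables (R : realType) (d : nat).
Local Notation T := (pt R d).
Implicit Types (k l : freq d) (x : T) (i : 'I_d) (b : bool).

Definition phase k x : R := 2 * pi * kdot k x.
(** Cosines and sines instead of exponentials keep all integrals real; complex coefficients are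
    reassembled in [ccoef]. *)
Definition tr b k x : R := if b then cos (phase k x) else sin (phase k x).

Lemma measurable_tr b k : measurable_fun [set: T] (tr b k).
Proof.
have mph : measurable_fun [set: T] (phase k).
  apply: measurable_funM => //; apply: measurable_sum => j.
  by apply: measurable_funM => //; exact: measurable_tnth.
have mcs (h : R -> R) : continuous h -> measurable_fun [set: T] (h \o phase k).
  by move=> ch; apply: measurableT_comp => //; exact: continuous_measurable_fun.
by case: b; [exact: (mcs _ (@continuous_cos R))|exact: (mcs _ (@continuous_sin R))].
Qed.

Lemma normr_cos_le1 (t : R) : `|cos t| <= 1.
Proof. by rewrite ler_norml cos_geN1 cos_le1. Qed.

Lemma normr_sin_le1 (t : R) : `|sin t| <= 1.
Proof. by rewrite ler_norml sin_geN1 sin_le1. Qed.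

Lemma normr_tr_le1 b k x : `|tr b k x| <= 1.
Proof. by rewrite /tr; case: b; [exact: normr_cos_le1|exact: normr_sin_le1]. Qed.

Lemma phase_upd k x i t : phase k (upd x i t) =
  2 * pi * ((tnth k i)%:~R * t) + (phase k x - 2 * pi * ((tnth k i)%:~R * tnth x i)).
Proof.
rewrite /phase /kdot (bigD1 i)//= [X in 2 * pi * X - _](bigD1 i)//= tnth_upd eqxx.
rewrite (eq_bigr (fun j => (tnth k j)%:~R * tnth x j)); last first.
  by move=> j /negbTE ji; rewrite tnth_upd ji.
by ring.
Qed.

Lemma tr_upd0 b k x i t : tnth k i = 0 -> tr b k (upd x i t) = tr b k x.
Proof. by move=> k0; rewrite /tr phase_upd k0 !mul0r !mulr0 subr0 add0r. Qed.

Lemma rint1_tr b k i x : tnth k i != 0 -> rint1 i (tr b k) x = 0.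
Proof.
move=> k0; rewrite /rint1 /tr; case: b.
  under eq_Rintegral => t _ do rewrite phase_upd.
  exact: Rintegral_cos_period.
under eq_Rintegral => t _ do rewrite phase_upd -cosBpihalf -addrA.
exact: Rintegral_cos_period.
Qed.

Lemma phaseD k l x : phase [tuple tnth k j + tnth l j | j < d] x = phase k x + phase l x.
Proof.
rewrite /phase /kdot -mulrDr -big_split/=; congr (_ * _); apply: eq_bigr => j _.
by rewrite tnth_mktuple intrD mulrDl.
Qed.

Lemma phaseB k l x : phase [tuple tnth k j - tnth l j | j < d] x = phase k x - phase l x.
Proof.
rewrite /phase /kdot -mulrBr -sumrB/=; congr (_ * _); apply: eq_bigr => j _.
by rewrite tnth_mktuple intrB mulrBl.
Qed.

Lemma phaseN k x : phase [tuple - tnth k j | j < d] x = - phase k x.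
Proof.
rewrite /phase /kdot -mulrN -sumrN/=; congr (_ * _); apply: eq_bigr => j _.
by rewrite tnth_mktuple intrN mulNr.
Qed.

Definition freq0 : freq d := [tuple 0 | _ < d].

Lemma phase0 x : phase freq0 x = 0.
Proof.
rewrite /phase /kdot big1 ?mulr0// => j _.
by rewrite tnth_mktuple mul0r.
Qed.

Variable P : probability T R.
Local Notation intble g := (P.-integrable [set: T] (EFin \o g)).

Lemma integrable_mul_bounded (g phi : T -> R) (M : R) : intble g ->
  measurable_fun [set: T] phi -> (forall x, `|phi x| <= M) ->
  intble (fun x => g x * phi x).
Proof.
move=> ig mphi bphi.
have mg := integrable_measurable ig.
apply: (le_integrable measurableT _ _ (integrableZl measurableT M ig)).
  by apply/measurable_EFinP; exact: measurable_funM.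
move=> x _ /=; rewrite lee_fin mulrC !normrM ler_wpM2r//.
exact: le_trans (bphi x) (ler_norm _).
Qed.

Lemma integrable_bounded (phi : T -> R) (M : R) :
  measurable_fun [set: T] phi -> (forall x, `|phi x| <= M) -> intble phi.
Proof.
move=> mphi bphi.
have := integrable_mul_bounded (finite_measure_integrable_cst P 1 measurableT) mphi bphi.
by apply: eq_integrable => // x _ /=; rewrite mul1r.
Qed.

Lemma cvg_Rintegral_bounded (g : T -> R) (u : nat -> T -> R) (phi : T -> R) (M : R) :
  intble g -> (forall n, measurable_fun [set: T] (u n)) ->
  (forall n x, `|u n x| <= M) -> (forall x, u n x @[n --> \oo] --> phi x) ->
  \int[P]_x (g x * u n x) @[n --> \oo] --> \int[P]_x (g x * phi x).
Proof.
move=> ig mu bu cu.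
have mphi : measurable_fun [set: T] phi.
  by apply: (measurable_fun_cvg mu) => x _; exact: cu.
have bphi x : `|phi x| <= M.
  have cn : `|u n x| @[n --> \oo] --> `|phi x| by apply: cvg_norm; exact: cu.
  rewrite -(cvg_lim _ cn)//; apply: limr_le; first by apply/cvg_ex; exists `|phi x|.
  by near=> n; exact: bu.
apply: fine_cvg; rewrite fineK; last first.
  by apply: integrable_fin_num => //; exact: integrable_mul_bounded ig mphi bphi.
apply: (@dominated_cvg _ _ _ _ _ _ _ _ (fun x => M%:E * `|(EFin \o g) x|)%E) => //.
- by move=> n; apply/measurable_EFinP/measurable_funM => //;
  exact: integrable_measurable ig.
- move=> x _; apply: cvg_EFin; first by near=> n.
  by apply: cvgM; [exact: cvg_cst|exact: cu].
- by apply: integrableZl => //; exact: integrable_abse.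
- by move=> n x _ /=; rewrite lee_fin normrM mulrC ler_wpM2r.
Unshelve. all: by end_near. Qed.

Definition coef b k (g : T -> R) : R := \int[P]_x (g x * tr b k x).

Lemma integrable_mul_tr b k g : intble g -> intble (fun x => g x * tr b k x).
Proof. by move=> ig;
  exact: integrable_mul_bounded ig (measurable_tr b k) (normr_tr_le1 b k). Qed.

Hypothesis invP : invariant P.

(** If [k] vanishes at [i], the harmonic is constant along that coordinate and moves under the
    partial integral. Otherwise [rint1 i g] is the factor constant along it, and the harmonic alone
    integrates to 0. *)
Lemma coef_rint1 b k i g : intble g ->
  coef b k (rint1 i g) = if tnth k i == 0 then coef b k g else 0.
Proof.
move=> ig; have igt := integrable_mul_tr b k ig.
have iRI := integrable_rint1 invP i ig; have mRI := integrable_measurable iRI.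
have mg := integrable_measurable ig.
case: eqP => [k0|/eqP k0]; rewrite /coef.
  rewrite -[RHS](Rintegral_rint1 invP i igt); congr fine.
  apply: ae_eq_integral => //.
  - exact: measurable_int (integrable_mul_tr b k iRI).
  - exact: measurable_int (integrable_rint1 invP i igt).
  (* Moving the harmonic under the integral needs an integrable section, available for almost every
     [x]. *)
  have := ae_integrable1 (integrable_upd invP i ig).
  apply: filterS => x /= ix _; congr EFin.
  rewrite !rint1_avg//; last exact: integrable_measurable igt.
  rewrite /avg -[LHS]/(Rintegral (lam R) setT (fun t => g (upd x i t)) * tr b k x).
  rewrite -RintegralZr//; congr fine; apply: eq_integral => t _ /=.
  by rewrite tr_upd0.
have it := integrable_mul_tr b k iRI.
rewrite -(Rintegral_rint1 invP i it).
rewrite (_ : rint1 i _ = cst 0) ?Rintegral_cst ?mul0r//.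
apply/funext => x.
transitivity (\int[@lebesgue_measure R]_(t in `[0, 1[) (rint1 i g x * tr b k (upd x i t))).
  by apply: eq_Rintegral => t _ /=; rewrite rint1_upd.
rewrite RintegralZl//; first by rewrite -/(rint1 i (tr b k) x) rint1_tr// mulr0.
apply: measurable_bounded_integrable => //.
- suff h : (lebesgue_measure (`[0%R, 1%R[ : set R) < +oo)%E by exact: h.
  by rewrite lebesgue_measure_itv/= lte_fin ltr01 oppr0 adde0 ltry.
- apply: measurable_funTS; apply: measurableT_comp; first exact: measurable_tr.
  exact: measurable_upd1.
- exists 1; split => // M M1 t _ /=.
  exact: le_trans (normr_tr_le1 _ _ _) (ltW M1).
Qed.

Lemma coef_rint b k s g : intble g ->
  coef b k (rint s g) = if all (fun i => tnth k i == 0) s then coef b k g else 0.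
Proof.
move=> ig; elim: s => //= i s ih; rewrite coef_rint1//; last exact: integrable_rint.
by rewrite ih; case: eqP.
Qed.

Lemma Rintegral_tr b k : \int[P]_x tr b k x = (b && (k == freq0))%:R.
Proof.
have [->|k0] := eqVneq k freq0; last first.
  have [i ki] : exists i, tnth k i != 0.
    apply/existsP; apply: contraR k0 => /existsPn k0.
    apply/eqP/eq_from_tnth => j; rewrite tnth_mktuple; apply/eqP.
    by have := k0 j; rewrite negbK.
  rewrite andbF -(Rintegral_rint1 invP i); last first.
    exact: integrable_bounded (measurable_tr b k) (normr_tr_le1 b k).
  under eq_Rintegral => x _ do rewrite rint1_tr//.
  by rewrite Rintegral_cst// mul0r.
under eq_Rintegral => x _ do rewrite /tr phase0 cos0 sin0.
rewrite Rintegral_cst//= (probability_setT P) mulr1 andbT.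
by case: b.
Qed.

End TrigCoef.

(** * Uniqueness of Fourier coefficients *)

Section PolynomialStep.
Variable R : realType.

Lemma bernoulli_le (t : R) n : -1 <= t -> 1 + n%:R * t <= (1 + t) ^+ n.
Proof.
move=> t1; elim: n => [|n ih]; first by rewrite mul0r addr0 expr0.
have t10 : 0 <= 1 + t by rewrite addrC -lerBlDr sub0r.
rewrite exprSr; apply: le_trans (ler_wpM2r t10 ih).
rewrite -natr1 -subr_ge0.
rewrite (_ : _ - _ = n%:R * t ^+ 2); last by ring.
by rewrite mulr_ge0 ?sqr_ge0.
Qed.

(** With [r = sqrt z] the sequence is [n * r ^ n] times [r ^ n]: Bernoulli's inequality for [r^-1]
    bounds the first factor by [B], and the second tends to 0. *)
Lemma cvg_nexpr (z : R) : 0 <= z < 1 -> n%:R * z ^+ n @[n --> \oo] --> (0 : R).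
Proof.
move=> /andP[z0 z1]; have [->|zn0] := eqVneq z 0.
  apply: cvg_near_cst; near=> n.
  by rewrite expr0n (_ : (n == 0)%N = false) ?mulr0//; apply/negbTE;
    rewrite -lt0n; near: n; exact: nbhs_infty_gt.
pose r := Num.sqrt z.
have r0 : 0 < r by rewrite sqrtr_gt0 lt_def zn0.
have r1 : r < 1 by rewrite -sqrtr1 ltr_sqrt.
pose B := (r^-1 - 1)^-1.
have B0 : 0 < r^-1 - 1 by rewrite subr_gt0 invf_gt1.
have bound n : n%:R * r ^+ n <= B.
  rewrite -[B]mul1r ler_pdivlMr//.
  have h : 1 + n%:R * (r^-1 - 1) <= r^-1 ^+ n.
    rewrite -[in leRHS](subrK 1 r^-1) [_ + 1]addrC; apply: bernoulli_le.
    by rewrite (le_trans _ (ltW B0))// lerN10.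
  have rn0 : 0 < r ^+ n by rewrite exprn_gt0.
  have := ler_wpM2r (ltW rn0) h; rewrite -exprMn mulVf ?gt_eqF// expr1n.
  apply: le_trans; rewrite mulrDl mul1r mulrAC lerDr; exact: ltW.
apply: (@squeeze_cvgr _ _ _ _ (fun=> 0) (fun n => B * r ^+ n)).
- near=> n; apply/andP; split; first by rewrite mulr_ge0 ?exprn_ge0.
  rewrite -(sqr_sqrtr z0) -/r exprAC expr2 mulrA.
  by apply: ler_wpM2r; [rewrite exprn_ge0// ltW|exact: bound].
- exact: cvg_cst.
- rewrite -[X in _ --> X](mulr0 B); apply: cvgM; first exact: cvg_cst.
  by apply: cvg_expr; rewrite ger0_norm ?ltW.
Unshelve. all: by end_near. Qed.

(* The exponent [n * 2 ^ n], rather than [2 ^ n], makes the limit at the jump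
   [y = 1/2] equal to [0]. *)
Lemma cvg_poly_step (y : R) : 0 <= y <= 1 ->
  (1 - y ^+ n) ^+ (n * 2 ^ n) @[n --> \oo] --> ((y < 1/2)%R%:R : R).
Proof.
move=> /andP[y0 y1].
have yn n : 0 <= y ^+ n <= 1 by rewrite exprn_ge0//= exprn_ile1.
have u01 n : 0 <= (1 - y ^+ n) ^+ (n * 2 ^ n) <= 1.
  have /andP[yn0 yn1] := yn n.
  by rewrite exprn_ge0 ?subr_ge0//= exprn_ile1 ?subr_ge0 ?lerBlDr ?lerDl.
have ltw n : (n * 2 ^ n)%:R * y ^+ n = n%:R * (2 * y) ^+ n.
  by rewrite natrM natrX exprMn mulrA.
have [yh|yh] := ltP y (1/2) => /=.
  (* The lower bound is Bernoulli's inequality; it tends to 1 because [2 * y < 1]. *)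
  apply: (@squeeze_cvgr _ _ _ _ (fun n => 1 - n%:R * (2 * y) ^+ n) (fun=> 1)).
  - near=> n; have /andP[_ ->] := u01 n; rewrite andbT.
    rewrite -ltw -mulrN; apply: bernoulli_le.
    by rewrite lerN2; have /andP[] := yn n.
  - rewrite -[X in _ --> X](subr0 1); apply: cvgB; first exact: cvg_cst.
    by apply: cvg_nexpr; apply/andP; split; lra.
  - exact: cvg_cst.
(* Put [v = y ^+ n] and let [N] be the exponent. The product of [(1 - v) ^+ N] and [(1 + v) ^+ N] is
   at most 1, while Bernoulli and [2 * y >= 1] give [(1 + v) ^+ N >= n + 1]. *)
apply: (@squeeze_cvgr _ _ _ _ (fun=> 0) (fun n => n.+1%:R^-1)).
- near=> n; have /andP[-> _] := u01 n => /=.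
  have /andP[yn0 yn1] := yn n.
  rewrite -[leRHS]mul1r ler_pdivlMr ?ltr0n//.
  apply: (@le_trans _ _ ((1 - y ^+ n) ^+ (n * 2 ^ n) * (1 + y ^+ n) ^+ (n * 2 ^ n))).
    rewrite ler_wpM2l ?exprn_ge0 ?subr_ge0//.
    have ym1 : -1 <= y ^+ n by rewrite (le_trans _ yn0)// lerN10.
    apply: le_trans (bernoulli_le _ ym1).
    rewrite ltw -natr1 addrC lerD2l ler_peMr// exprn_ege1//; lra.
  rewrite -exprMn -subr_sqr expr1n exprn_ile1//.
    by rewrite subr_ge0 exprn_ile1.
  by rewrite lerBlDr lerDl sqr_ge0.
- exact: cvg_cst.
- exact: cvg_harmonic.
Unshelve. all: by end_near. Qed.

End PolynomialStep.

(** * From trigonometric polynomials to indicators of Borel sets *)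

Section Uniqueness.
Variables (R : realType) (d : nat).
Local Notation T := (pt R d).

Inductive trigpoly : (T -> R) -> Prop :=
| trigpoly_tr b k : trigpoly (@tr R d b k)
| trigpolyD p q : trigpoly p -> trigpoly q -> trigpoly (fun x => p x + q x)
| trigpolyZ c p : trigpoly p -> trigpoly (fun x => c * p x).

Lemma trigpoly_cst c : trigpoly (fun=> c).
Proof.
rewrite (_ : (fun=> c) = (fun x => c * tr true (freq0 d) x)).
  exact/trigpolyZ/trigpoly_tr.
by apply/funext => x; rewrite /tr phase0 cos0 mulr1.
Qed.

(** Product-to-sum formulas: each product combines one kind of harmonic at the sum and at the
    difference of the frequencies. *)
Lemma trigpoly_trM b k b' k' : trigpoly (fun x => @tr R d b k x * tr b' k' x).
Proof.
pose kp : freq d := [tuple tnth k j + tnth k' j | j < d].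
pose km : freq d := [tuple tnth k j - tnth k' j | j < d].
have comb b0 c1 c2 : trigpoly (fun x => c1 * tr b0 kp x + c2 * tr b0 km x).
  by apply: trigpolyD; apply: trigpolyZ; exact: trigpoly_tr.
have [b0 [c1 [c2 E]]] : exists b0 c1 c2, forall x,
    @tr R d b k x * tr b' k' x = c1 * tr b0 kp x + c2 * tr b0 km x.
  case: b; case: b'; [exists true, (2^-1), (2^-1)|exists false, (2^-1), (- 2^-1)|
    exists false, (2^-1), (2^-1)|exists true, (- 2^-1), (2^-1)] => x;
  by rewrite /tr !phaseD !phaseB ?cosB ?cosD ?sinB ?sinD; field.
by rewrite (_ : (fun x => _) = (fun x => c1 * tr b0 kp x + c2 * tr b0 km x)) //;
  apply/funext.
Qed.

Lemma trigpolyM p q : trigpoly p -> trigpoly q -> trigpoly (fun x => p x * q x).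
Proof.
move=> tp tq; elim: tp => [b k|p1 p2 _ h1 _ h2|c p1 _ h].
- elim: tq => [b' k'|q1 q2 _ h1 _ h2|c q1 _ h]; first exact: trigpoly_trM.
  + by under eq_fun do rewrite mulrDr; exact: trigpolyD.
  + by under eq_fun do rewrite mulrCA; exact: trigpolyZ.
- by under eq_fun do rewrite mulrDl; exact: trigpolyD.
- by under eq_fun do rewrite -mulrA; exact: trigpolyZ.
Qed.

Lemma trigpolyX p n : trigpoly p -> trigpoly (fun x => p x ^+ n).
Proof.
move=> tp; elim: n => [|n ih].
  by under eq_fun do rewrite expr0; exact: trigpoly_cst.
by under eq_fun do rewrite exprS; exact: trigpolyM.
Qed.

Lemma measurable_trigpoly p : trigpoly p -> measurable_fun [set: T] p.
Proof.
elim=> [b k|p1 p2 _ h1 _ h2|c p1 _ h]; first exact: measurable_tr.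
- exact: measurable_funD.
- exact: measurable_funM.
Qed.

Lemma bounded_trigpoly p : trigpoly p -> exists M, forall x, `|p x| <= M.
Proof.
elim=> [b k|p1 p2 _ [M1 h1] _ [M2 h2]|c p1 _ [M h]].
- by exists 1 => x; exact: normr_tr_le1.
- by exists (M1 + M2) => x; rewrite (le_trans (ler_normD _ _))// lerD.
- by exists (`|c| * M) => x; rewrite normrM ler_wpM2l.
Qed.

Variable P : probability T R.
Hypothesis invP : invariant P.
Local Notation intble g := (P.-integrable [set: T] (EFin \o g)).
Variable g : T -> R.
Hypothesis ig : intble g.
Hypothesis g0 : forall b k, coef P b k g = 0.

Lemma eq_Rintegral_box01 (u v : T -> R) : measurable_fun [set: T] u ->
  measurable_fun [set: T] v -> (forall x, box01 x -> u x = v x) ->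
  \int[P]_x u x = \int[P]_x v x.
Proof.
move=> mu mv uv; congr fine; apply: ae_eq_integral => //.
- exact/measurable_EFinP.
- exact/measurable_EFinP.
have mb := @measurable_box01 R d.
exists (~` @box01 R d); split.
- exact: measurableC.
- have Pb := probability_box01 invP.
  transitivity (1 - P (@box01 R d))%E; first exact: probability_setC.
  by rewrite Pb subee.
- by move=> x /= h bx; apply: h => _; rewrite uv.
Qed.

(** Quantifying over [p] makes the class stable under multiplication by trigonometric polynomials,
    and boundedness allows dominated convergence; both are needed to reach indicators. *)
Definition annih (phi : T -> R) := [/\ measurable_fun [set: T] phi,
  exists M, forall x, `|phi x| <= M &
  forall p, trigpoly p -> \int[P]_x (g x * (p x * phi x)) = 0].

Let measurable_pphi p (phi : T -> R) : trigpoly p -> measurable_fun [set: T] phi ->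
  measurable_fun [set: T] (fun x => g x * (p x * phi x)).
Proof.
move=> tp mphi; apply: measurable_funM; first exact: integrable_measurable ig.
by apply: measurable_funM => //; exact: measurable_trigpoly.
Qed.

Let integrable_pphi p (phi : T -> R) : trigpoly p -> measurable_fun [set: T] phi ->
  (exists M, forall x, `|phi x| <= M) -> intble (fun x => g x * (p x * phi x)).
Proof.
move=> tp mphi [M hM]; have [N hN] := bounded_trigpoly tp.
apply: (@integrable_mul_bounded _ _ _ _ (fun x => p x * phi x) (N * M) ig).
  by apply: measurable_funM => //; exact: measurable_trigpoly.
by move=> x; rewrite normrM; apply: ler_pM.
Qed.

Lemma annih1 : annih (fun=> 1).
Proof.
split; [exact: measurable_cst|by exists 1 => x; rewrite normr1|].
have bd1 : exists M, forall x : T, `|(fun=> 1) x : R| <= M by exists 1 => x;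
  rewrite normr1.
move=> p; elim=> [b k|p1 p2 t1 h1 t2 h2|c p1 t1 h].
- by under eq_Rintegral => x _ do rewrite mulr1; exact: g0.
- under eq_Rintegral => x _ do rewrite mulrDl mulrDr.
  rewrite RintegralD//;
    [|exact: integrable_pphi t1 _ bd1|exact: integrable_pphi t2 _ bd1].
  by rewrite h1 h2 addr0.
- under eq_Rintegral => x _ do rewrite -mulrA mulrCA.
  rewrite RintegralZl//; last exact: integrable_pphi t1 _ bd1.
  by rewrite h mulr0.
Qed.

Lemma annihB phi psi : annih phi -> annih psi -> annih (fun x => phi x - psi x).
Proof.
move=> [m1 b1 h1] [m2 b2 h2]; split; first exact: measurable_funB.
  move: b1 b2 => [M hM] [N hN]; exists (M + N) => x.
  by rewrite (le_trans (ler_normB _ _))// lerD.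
move=> p tp; under eq_Rintegral => x _ do rewrite mulrBr mulrBr.
by rewrite RintegralB ?h1 ?h2 ?subr0//; exact: integrable_pphi.
Qed.

Lemma annih_mul_trigpoly phi q : trigpoly q -> annih phi -> annih (fun x => phi x * q x).
Proof.
move=> tq [m1 [M hM] h1]; have [N hN] := bounded_trigpoly tq; split.
- by apply: measurable_funM => //; exact: measurable_trigpoly.
- by exists (M * N) => x; rewrite normrM ler_pM.
move=> p tp; rewrite -[RHS](h1 _ (trigpolyM tp tq)).
by apply: eq_Rintegral => x _; rewrite -mulrA [_ * phi x]mulrC.
Qed.

Lemma annih_lim (u : nat -> T -> R) phi (M : R) : (forall n, annih (u n)) ->
  (forall n x, `|u n x| <= M) -> (forall x, u n x @[n --> \oo] --> phi x) -> annih phi.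
Proof.
move=> au bu cu.
have mu n : measurable_fun [set: T] (u n) by have [] := au n.
split.
- by apply: (measurable_fun_cvg mu) => x _; exact: cu.
- exists M => x; have cn : `|u n x| @[n --> \oo] --> `|phi x|
  by apply: cvg_norm; exact: cu.
  rewrite -(cvg_lim _ cn)//; apply: limr_le; first by apply/cvg_ex; exists `|phi x|.
  by near=> n; exact: bu.
move=> p tp; have [N hN] := bounded_trigpoly tp.
have : \int[P]_x (g x * (p x * u n x)) @[n --> \oo] --> \int[P]_x (g x * (p x * phi x)).
  apply: (cvg_Rintegral_bounded (M := N * M) ig).
  - by move=> n; apply: measurable_funM => //; exact: measurable_trigpoly.
  - by move=> n x; rewrite normrM ler_pM.
  - by move=> x; apply: cvgM; [exact: cvg_cst|exact: cu].
have -> : (fun n => \int[P]_x (g x * (p x * u n x))) = fun=> 0.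
  by apply/funext => n; have [_ _] := au n; exact.
by move=> /cvg_lim <- //; rewrite lim_cst.
Unshelve. all: by end_near. Qed.

(** [P] is concentrated on the box, so values outside it can be changed freely. *)
Lemma annih_box01 (phi psi : T -> R) (M : R) : annih phi -> measurable_fun [set: T] psi ->
  (forall x, `|psi x| <= M) -> (forall x, box01 x -> phi x = psi x) -> annih psi.
Proof.
move=> [m1 b1 h1] m2 b2 pp; split => //; first by exists M.
move=> p tp; rewrite -[RHS](h1 _ tp); apply: eq_Rintegral_box01.
- exact: measurable_pphi.
- exact: measurable_pphi.
- by move=> x bx; rewrite pp.
Qed.

(* Sets whose indicator multiplies annihilated functions to annihilated
   functions: stability under intersection is then automatic. *)
Definition annih_set : set (set T) := [set E | measurable E /\
  forall phi, annih phi -> annih (fun x => phi x * \1_E x)].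

Lemma annih_setC E : annih_set E -> annih_set (~` E).
Proof.
move=> [mE hE]; split; first exact: measurableC.
move=> phi aphi; have := annihB aphi (hE _ aphi).
by congr annih; apply/funext => x; rewrite !indicE in_setC; case: (x \in E) => /=; ring.
Qed.

(** At every point the finite products of indicators are eventually equal to the indicator of the
    intersection, so [annih_lim] applies. *)
Lemma annih_set_bigcap (F : nat -> set T) : (forall n, annih_set (F n)) ->
  annih_set (\bigcap_n F n).
Proof.
move=> hF; split; first by apply: bigcapT_measurable => n; have [] := hF n.
move=> phi aphi; pose u n x := phi x * \prod_(i < n) \1_(F i) x : R.
have [_ [M hM] _] := aphi.
have i01 n x : 0 <= \prod_(i < n) (\1_(F i) x : R) <= 1.
  by apply/andP; split; [apply: prodr_ge0|apply: prodr_ile1] => i _;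
    rewrite indicE ler0n//= lern1 leq_b1.
apply: (@annih_lim u _ M).
- elim=> [|n ih]; rewrite /u.
    by under eq_fun do rewrite big_ord0 mulr1.
  under eq_fun do rewrite big_ord_recr/= mulrA.
  by have [_] := hF n; apply.
- move=> n x; rewrite normrM -[leRHS]mulr1 ler_pM//.
  by have /andP[? ?] := i01 n x; rewrite ger0_norm.
move=> x; have [xF|nxF] := boolP (x \in \bigcap_n F n).
  apply: cvg_near_cst; near=> n; rewrite /u indicE xF big1// => i _.
  by rewrite indicE mem_set//; move/set_mem: xF; apply.
have [m hm] : exists m, ~ F m x.
  by apply/existsNP => h; move: nxF; rewrite notin_setE; apply => n _; exact: h.
apply: cvg_near_cst; near=> n; rewrite indicE (negbTE nxF) /u.
have mn : (m < n)%N by near: n; exact: nbhs_infty_gt.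
by rewrite (bigD1 (Ordinal mn))//= indicE memNset// mul0r.
Unshelve. all: by end_near. Qed.

Lemma sigma_algebra_annih_set : sigma_algebra [set: T] annih_set.
Proof.
split=> [|E hE|F hF].
- split=> // phi aphi; have := annihB aphi aphi.
  by congr annih; apply/funext => x; rewrite indic0 mulr0 subrr.
- by rewrite setTD; exact: annih_setC.
- rewrite -[X in annih_set X]setCK setC_bigcup; apply/annih_setC/annih_set_bigcap => n.
  exact: annih_setC.
Qed.

(** On the circle, the parameters [t] from 0 to [a] sweep the arc with midpoint angle [pi * a] and
    half-width [pi * a]. Outside it, and only there, the cosine of the distance to the midpoint is
    below [cos (pi * a)]. *)
Lemma cos_arc (t a : R) : 0 <= t < 1 -> 0 <= a < 1 ->
  (cos (2 * pi * t - pi * a) < cos (pi * a)) = (a < t).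
Proof.
move=> /andP[t0 t1] /andP[a0 a1]; have p0 := pi_gt0 R.
have ap : pi * a \in `[0, (pi : R)].
  by rewrite in_itv/=; apply/andP; split; nra.
have [ta|at_] := leP t a.
  apply/negbTE; rewrite -leNgt; have [s0|s0] := leP (pi * a) (2 * pi * t).
    have sp : 2 * pi * t - pi * a \in `[0, (pi : R)] by rewrite in_itv/=;
      apply/andP; split; nra.
    by rewrite leNgt ltr_cos// -leNgt; nra.
  rewrite -[cos (2 * pi * t - _)]cosN opprB.
  have sp : pi * a - 2 * pi * t \in `[0, (pi : R)] by rewrite in_itv/=;
    apply/andP; split; nra.
  by rewrite leNgt ltr_cos// -leNgt; nra.
have [s0|s0] := leP (2 * pi * t - pi * a) pi.
  have sp : 2 * pi * t - pi * a \in `[0, (pi : R)] by rewrite in_itv/=;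
    apply/andP; split; nra.
  by rewrite ltr_cos//; nra.
(* Beyond [pi] the angle is reflected back to the range where the cosine decreases. *)
have sp : 2 * pi - (2 * pi * t - pi * a) \in `[0, (pi : R)]
  by rewrite in_itv/=; apply/andP; split; nra.
have -> : cos (2 * pi * t - pi * a) = cos (2 * pi - (2 * pi * t - pi * a)).
  by rewrite [RHS]cosB [2 * pi]mulr_natl cos2pi sin2pi mul1r mul0r addr0.
by rewrite ltr_cos//; nra.
Qed.

(** Within the box the half-space is an arc in one coordinate, described by a threshold on the
    trigonometric polynomial [y]; the polynomials [q n] in [y] converge boundedly to its
    indicator. *)
Lemma annih_half (j : 'I_d) (a : R) : annih_set [set x | tnth x j <= a].
Proof.
have mH := @measurable_le_tnth R d j a.
set H := [set x | _] in mH *; split => // phi aphi.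
have [mphi [M hM] _] := aphi.
have i1 (E : set T) x : `|\1_E x : R| <= 1 by rewrite indicE; case: (_ \in _);
  rewrite ?normr1 ?normr0 ?ler01.
have mphiH : measurable_fun [set: T] (fun x => phi x * \1_H x).
  by apply: measurable_funM => //; exact: measurable_indic.
have bphiH x : `|phi x * \1_H x| <= M.
  by rewrite normrM -[leRHS]mulr1 ler_pM.
(* For [a < 0] or [a >= 1] the indicator is constant on the box and no arc is involved. *)
have [a0|a0] := ltP a 0.
  apply: (annih_box01 (annihB aphi aphi) mphiH bphiH) => x bx.
  rewrite subrr indicE memNset ?mulr0// /H/=; apply/negP; rewrite -ltNge.
  by apply: lt_le_trans a0 _; have /andP[] := bx j.
have [a1|a1] := leP 1 a.
  apply: (annih_box01 aphi mphiH bphiH) => x bx.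
  rewrite indicE mem_set ?mulr1// /H/=.
  by rewrite (le_trans _ a1)// ltW//; have /andP[] := bx j.
pose k : freq d := [tuple (i == j)%:Z | i < d].
have phk (x : T) : phase k x = 2 * pi * tnth x j.
  rewrite /phase /kdot (bigD1 j)//= tnth_mktuple eqxx mul1r big1 ?addr0//.
  by move=> i /negbTE ij; rewrite tnth_mktuple ij mul0r.
(* The difference of the two cosines lies between -2 and 2; adding 2 and dividing by 4 brings it
   between 0 and 1 and moves its sign change to the threshold 1/2. *)
pose y x : R := (2 + cos (phase k x - pi * a) - cos (pi * a)) / 4.
have ty : trigpoly y.
  rewrite (_ : y = (fun x => ((2 - cos (pi * a)) / 4 + ((cos (pi * a) / 4) * tr true k x +
     (sin (pi * a) / 4) * tr false k x)))).
    apply: trigpolyD; first exact: trigpoly_cst.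
    by apply: trigpolyD; apply: trigpolyZ; exact: trigpoly_tr.
  by apply/funext => x; rewrite /y /tr cosB; field.
have y01 x : 0 <= y x <= 1.
  have := cos_le1 (phase k x - pi * a); have := cos_geN1 (phase k x - pi * a).
  have := cos_le1 (pi * a); have := cos_geN1 (pi * a).
  by rewrite /y => *; apply/andP; split; lra.
pose q n x := 1 - (1 - y x ^+ n) ^+ (n * 2 ^ n).
have tq n : trigpoly (q n).
  rewrite (_ : q n = fun x => 1 + (-1) * (1 + (-1) * y x ^+ n) ^+ (n * 2 ^ n)).
    apply: trigpolyD; first exact: trigpoly_cst.
    apply: trigpolyZ; apply: trigpolyX; apply: trigpolyD; first exact: trigpoly_cst.
    by apply: trigpolyZ; exact: trigpolyX.
  by apply/funext => x; rewrite /q !mulN1r.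
have q01 n x : `|q n x| <= 1.
  have /andP[y0 y1] := y01 x.
  have : 0 <= (1 - y x ^+ n) ^+ (n * 2 ^ n) <= 1.
    by rewrite exprn_ge0 ?exprn_ile1 ?subr_ge0 ?exprn_ile1// lerBlDr lerDl exprn_ge0.
  by move=> /andP[? ?]; rewrite /q ler_norml; apply/andP; split; lra.
have aq : annih (fun x => phi x * (1 - (y x < 1/2)%R%:R)).
  apply: (@annih_lim (fun n x => phi x * q n x) _ M).
  - by move=> n; exact: annih_mul_trigpoly.
  - by move=> n x; rewrite normrM -[leRHS]mulr1 ler_pM.
  - move=> x; apply: cvgM; first exact: cvg_cst.
    by apply: cvgB; [exact: cvg_cst|exact: cvg_poly_step].
apply: (annih_box01 aq mphiH bphiH) => x bx; congr (_ * _).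
have -> : (y x < 1/2) = (a < tnth x j).
  rewrite -(cos_arc (bx j)) ?a0// /y phk.
  by apply/idP/idP => h; lra.
rewrite indicE ltNge; case: (boolP (tnth x j <= a)) => h.
  by rewrite mem_set// subr0.
by rewrite memNset ?subrr//; apply/negP.
Qed.

(** Every Borel set [E] is in [annih_set]; applied to the constant 1, with the constant polynomial
    1, this says that [g] has integral 0 over [E]. *)
Lemma coef_eq0_ae : ae_eq P [set: T] (EFin \o g) (EFin \o cst 0).
Proof.
apply: (integral_ae_eq measurableT ig); first by apply/measurable_EFinP;
  exact: measurable_cst.
move=> E _ mE.
have [_ hE] : annih_set E.
  exact: (measurable_pt_ind sigma_algebra_annih_set annih_half).
have [_ _ h0] := hE _ annih1; have h := h0 _ (trigpoly_cst 1).
rewrite [RHS]integral0 integral_mkcond.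
have iE : intble (fun x => g x * \1_E x).
  apply: (integrable_mul_bounded (M := 1) ig); first exact: measurable_indic.
  by move=> x; rewrite indicE; case: (_ \in _); rewrite ?normr1 ?normr0 ?ler01.
transitivity (\int[P]_x (g x * \1_E x)%:E)%E.
  apply: eq_integral => x _; rewrite patchE indicE/=.
  by case: (x \in E); rewrite ?mulr1 ?mulr0.
rewrite -[LHS]fineK; last exact: integrable_fin_num.
congr EFin; rewrite -[RHS]h; apply: eq_Rintegral => x _.
by rewrite mul1r mul1r.
Qed.

End Uniqueness.

(** * Functions with absolutely summable coefficients *)

Section ComplexParts.
Variable R : rcfType.
Implicit Types x y : R[i].

Lemma ReD x y : complex.Re (x + y) = complex.Re x + complex.Re y.
Proof. by case: x => ? ?; case: y. Qed.

Lemma ImD x y : complex.Im (x + y) = complex.Im x + complex.Im y.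
Proof. by case: x => ? ?; case: y. Qed.

Lemma ReN x : complex.Re (- x) = - complex.Re x.
Proof. by case: x. Qed.

Lemma ImN x : complex.Im (- x) = - complex.Im x.
Proof. by case: x. Qed.

Lemma Re_sum (I : Type) (s : seq I) (Q : pred I) (F : I -> R[i]) :
  complex.Re (\sum_(i <- s | Q i) F i) = \sum_(i <- s | Q i) complex.Re (F i).
Proof. exact: (big_morph _ ReD (erefl : complex.Re (0 : R[i]) = 0)). Qed.

Lemma Im_sum (I : Type) (s : seq I) (Q : pred I) (F : I -> R[i]) :
  complex.Im (\sum_(i <- s | Q i) F i) = \sum_(i <- s | Q i) complex.Im (F i).
Proof. exact: (big_morph _ ImD (erefl : complex.Im (0 : R[i]) = 0)). Qed.

Lemma normcE x : Normc.normc x = Num.sqrt (complex.Re x ^+ 2 + complex.Im x ^+ 2).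
Proof. by case: x. Qed.

Lemma normc_ge0 x : 0 <= Normc.normc x.
Proof. by rewrite normcE sqrtr_ge0. Qed.

Lemma normc_sum (I : Type) (s : seq I) (Q : pred I) (F : I -> R[i]) :
  Normc.normc (\sum_(i <- s | Q i) F i) <= \sum_(i <- s | Q i) Normc.normc (F i).
Proof.
elim/big_rec2: _ => [|i u v _ h]; first by rewrite Normc.normc0.
by rewrite (le_trans (le_normcD _ _))// lerD2l.
Qed.

Lemma normc_Re x : `|complex.Re x| <= Normc.normc x.
Proof. by rewrite normcE -sqrtr_sqr ler_wsqrtr// lerDl sqr_ge0. Qed.

Lemma normc_Im x : `|complex.Im x| <= Normc.normc x.
Proof. by rewrite normcE -sqrtr_sqr ler_wsqrtr// lerDr sqr_ge0. Qed.

End ComplexParts.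

(** * Fourier series with absolutely summable coefficients *)

Section AbsolutelySummable.
Variables (R : realType) (d : nat) (P : probability (pt R d) R).
Hypothesis invP : invariant P.
Local Notation T := (pt R d).
Local Notation intble g := (P.-integrable [set: T] (EFin \o g)).

Lemma integrableD_fun (g h : T -> R) : intble g -> intble h ->
  intble (fun x => g x + h x).
Proof. by move=> ig ih; exact: (integrableD measurableT ig ih). Qed.

Lemma integrableB_fun (g h : T -> R) : intble g -> intble h ->
  intble (fun x => g x - h x).
Proof. by move=> ig ih; exact: (integrableB measurableT ig ih). Qed.

Lemma integrableZ_fun (c : R) (g : T -> R) : intble g -> intble (fun x => c * g x).
Proof. by move=> ig; exact: (integrableZl measurableT c ig). Qed.

Lemma integrable_sum_fun (I : Type) (s : seq I) (Q : pred I) (F : I -> T -> R) :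
  (forall i, Q i -> intble (F i)) -> intble (fun x => \sum_(i <- s | Q i) F i x).
Proof.
move=> iF; elim: s => [|i s ih].
  by under eq_fun do rewrite big_nil;
    exact: (finite_measure_integrable_cst P 0 measurableT).
have [Qi|nQi] := boolP (Q i).
  under eq_fun do rewrite big_cons Qi.
  by apply: integrableD_fun => //; exact: iF.
by under eq_fun do rewrite big_cons (negbTE nQi).
Qed.

Lemma Rintegral_sum_fun (I : Type) (s : seq I) (Q : pred I) (F : I -> T -> R) :
  (forall i, Q i -> intble (F i)) ->
  \int[P]_x \sum_(i <- s | Q i) F i x = \sum_(i <- s | Q i) \int[P]_x F i x.
Proof.
move=> iF; elim: s => [|i s ih].
  under eq_Rintegral => x _ do rewrite big_nil.
  by rewrite Rintegral_cst// mul0r big_nil.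
rewrite big_cons; case: ifPn => Qi; last first.
  by rewrite -ih; apply: eq_Rintegral => x _; rewrite big_cons (negbTE Qi).
rewrite -ih -RintegralD//; [|exact: iF|exact: integrable_sum_fun].
by apply: eq_Rintegral => x _; rewrite big_cons Qi.
Qed.

Lemma coefB b k (g h : T -> R) : intble g -> intble h ->
  coef P b k (fun x => g x - h x) = coef P b k g - coef P b k h.
Proof.
move=> ig ih; rewrite /coef -RintegralB//;
  [|exact: integrable_mul_tr|exact: integrable_mul_tr].
by apply: eq_Rintegral => x _; rewrite mulrBl.
Qed.

Lemma coef_sum b k (I : Type) (s : seq I) (Q : pred I) (F : I -> T -> R) :
  (forall i, Q i -> intble (F i)) ->
  coef P b k (fun x => \sum_(i <- s | Q i) F i x) = \sum_(i <- s | Q i) coef P b k (F i).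
Proof.
move=> iF; rewrite /coef -Rintegral_sum_fun; last by move=> i Qi;
  exact/integrable_mul_tr/iF.
by apply: eq_Rintegral => x _; rewrite mulr_suml.
Qed.

(* The complex Fourier coefficient of [g + i h]. *)
Definition ccoef (g h : T -> R) (k : freq d) : R[i] :=
  ((coef P true k g + coef P false k h) +i* (coef P true k h - coef P false k g))%C.

(** One complex coefficient mixes the coefficients of [g] and [h]; the equations at [k] and at [- k]
    together separate the four real unknowns. *)
Lemma ccoef0 (g h : T -> R) : intble g -> intble h ->
  (forall k, ccoef g h k = 0) ->
  (forall b k, coef P b k g = 0) /\ (forall b k, coef P b k h = 0).
Proof.
move=> ig ih h0.
have trN b k x : tr b [tuple - tnth k j | j < d] x = (-1) ^+ (~~ b) * tr b k x :> R.
  by rewrite /tr phaseN; case: b; rewrite ?cosN ?sinN ?expr0 ?expr1 ?mul1r ?mulN1r.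
have coefN b k u : intble u ->
    coef P b [tuple - tnth k j | j < d] u = (-1) ^+ (~~ b) * coef P b k u.
  move=> iu; rewrite /coef -RintegralZl//; last exact: integrable_mul_tr.
  by apply: eq_Rintegral => x _; rewrite trN mulrCA.
have key k : [/\ coef P true k g = 0, coef P false k g = 0,
    coef P true k h = 0 & coef P false k h = 0].
  have [e1 e2] := h0 k; have [] := h0 [tuple - tnth k j | j < d].
  rewrite !coefN// !(expr0, expr1) !(mul1r, mulN1r) => e3 e4.
  by split; lra.
by split=> -[] k; have [] := key k.
Qed.

Section Series.
Variable c : freq d -> R[i].
Variable C : R.
Hypothesis sumC : forall s : seq (freq d), uniq s ->
  \sum_(k <- s) Normc.normc (c k) <= C.

(** This is [c k] times the exponential [exp (2 pi i k.x)], written out in real and imaginary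
    parts. *)
Definition term k (x : T) : R[i] :=
  ((complex.Re (c k) * tr true k x - complex.Im (c k) * tr false k x) +i*
   (complex.Re (c k) * tr false k x + complex.Im (c k) * tr true k x))%C.

Lemma normc_term k x : Normc.normc (term k x) = Normc.normc (c k).
Proof.
rewrite !normcE /=; congr Num.sqrt.
rewrite [RHS](_ : _ = (complex.Re (c k) ^+ 2 + complex.Im (c k) ^+ 2) *
  (cos (phase k x) ^+ 2 + sin (phase k x) ^+ 2)); first by rewrite /tr; ring.
by rewrite cos2Dsin2 mulr1.
Qed.

(** Frequencies are enumerated by their codes; a number that codes no frequency contributes
    nothing. *)
Definition terms (n : nat) : seq (freq d) := pmap pickle_inv (iota 0 n).

Lemma uniq_terms n : uniq (terms n).
Proof. exact: (pmap_uniq pickle_invK (iota_uniq _ _)). Qed.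

Lemma mem_terms k n : (pickle k < n)%N -> k \in terms n.
Proof.
move=> kn; rewrite mem_pmap; apply/mapP; exists (pickle k); first by rewrite mem_iota.
by rewrite pickleK_inv.
Qed.

Lemma sum_terms (V : zmodType) (F : freq d -> V) n :
  \sum_(k <- terms n) F k = series (fun m => oapp F 0 (pickle_inv m)) n.
Proof.
rewrite seriesEnat /= /index_iota subn0 /terms.
elim: (iota 0 n) => [|m s ih]; first by rewrite !big_nil.
by rewrite big_cons -ih /=; case: (pickle_inv m) => [k|]; rewrite /= ?big_cons ?add0r.
Qed.

Lemma cvg_terms (F : freq d -> R) : (forall k, `|F k| <= Normc.normc (c k)) ->
  cvgn (fun n => \sum_(k <- terms n) F k).
Proof.
move=> hF; under eq_fun do rewrite sum_terms.
apply: (@normed_cvg R R).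
pose a m := oapp (fun k => Normc.normc (c k)) 0 (pickle_inv m : option (freq d)).
have a0 m : 0 <= a m by rewrite /a; case: (pickle_inv m) => //= k; exact: normc_ge0.
apply: (@series_le_cvg _ _ a) => //.
  by move=> m /=.
  move=> m; rewrite /a /=; case: (pickle_inv m) => [k|] /=; first exact: hF.
  by rewrite normr0.
apply: nondecreasing_is_cvgn.
  by apply/nondecreasing_seqP => n; rewrite seriesSr lerDl.
by exists C => _ [n _ <-]; rewrite /a -sum_terms; exact/sumC/uniq_terms.
Qed.

Definition psum n x : R[i] := \sum_(k <- terms n) term k x.

Definition fsum1 x : R := limn (fun n => complex.Re (psum n x)).
Definition fsum2 x : R := limn (fun n => complex.Im (psum n x)).

Lemma normc_psum n x : Normc.normc (psum n x) <= C.
Proof.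
rewrite (le_trans (normc_sum _ _ _))// (eq_bigr (fun k => Normc.normc (c k))).
  exact/sumC/uniq_terms.
by move=> k _; exact: normc_term.
Qed.

Lemma cvg_Re_psum x : (fun n => complex.Re (psum n x)) @ \oo --> fsum1 x.
Proof.
suff : cvgn (fun n => complex.Re (psum n x)) by [].
under eq_fun do rewrite Re_sum.
by apply: cvg_terms => k; rewrite -(normc_term k x); exact: normc_Re.
Qed.

Lemma cvg_Im_psum x : (fun n => complex.Im (psum n x)) @ \oo --> fsum2 x.
Proof.
suff : cvgn (fun n => complex.Im (psum n x)) by [].
under eq_fun do rewrite Im_sum.
by apply: cvg_terms => k; rewrite -(normc_term k x); exact: normc_Im.
Qed.

(** The bound passes to the limit through the squared modulus, a polynomial in the two real
    parts. *)
Lemma normc_fsum x : Normc.normc (fsum1 x +i* fsum2 x)%C <= C.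
Proof.
have C0 : 0 <= C := le_trans (normc_ge0 _) (normc_psum 0 x).
rewrite normcE/= -(ger0_norm C0) -sqrtr_sqr ler_wsqrtr//.
have h : (fun n => complex.Re (psum n x) ^+ 2 + complex.Im (psum n x) ^+ 2) @ \oo -->
    fsum1 x ^+ 2 + fsum2 x ^+ 2.
  have hr := @cvg_Re_psum x; have hi := @cvg_Im_psum x.
  exact: (cvgD (cvgM hr hr) (cvgM hi hi)).
rewrite -(cvg_lim _ h)//; apply: limr_le; first by apply/cvg_ex; eexists; exact: h.
near=> n; have := normc_psum n x; rewrite normcE => hn.
by rewrite -(ler_sqrt _ (sqr_ge0 C)) sqrtr_sqr ger0_norm.
Unshelve. all: by end_near. Qed.

Lemma measurable_Re_psum n : measurable_fun [set: T] (fun x => complex.Re (psum n x)).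
Proof.
under eq_fun do rewrite Re_sum; apply: measurable_sum => k.
rewrite -/(measurable_fun setT (fun x =>
  complex.Re (c k) * tr true k x - complex.Im (c k) * tr false k x)).
by apply: measurable_funB; apply: measurable_funM => //; exact: measurable_tr.
Qed.

Lemma measurable_Im_psum n : measurable_fun [set: T] (fun x => complex.Im (psum n x)).
Proof.
under eq_fun do rewrite Im_sum; apply: measurable_sum => k.
rewrite -/(measurable_fun setT (fun x =>
  complex.Re (c k) * tr false k x + complex.Im (c k) * tr true k x)).
by apply: measurable_funD; apply: measurable_funM => //; exact: measurable_tr.
Qed.

Lemma Re_psum_le n x : `|complex.Re (psum n x)| <= C.
Proof. exact: le_trans (normc_Re _) (normc_psum n x). Qed.

Lemma Im_psum_le n x : `|complex.Im (psum n x)| <= C.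
Proof. exact: le_trans (normc_Im _) (normc_psum n x). Qed.

Lemma integrable_fsum1 : intble fsum1.
Proof.
apply: (@integrable_bounded _ _ _ _ C).
  by apply: (measurable_fun_cvg measurable_Re_psum) => x _; exact: (@cvg_Re_psum x).
by move=> x; exact: le_trans (normc_Re (fsum1 x +i* fsum2 x)%C) (normc_fsum x).
Qed.

Lemma integrable_fsum2 : intble fsum2.
Proof.
apply: (@integrable_bounded _ _ _ _ C).
  by apply: (measurable_fun_cvg measurable_Im_psum) => x _; exact: (@cvg_Im_psum x).
by move=> x; exact: le_trans (normc_Im (fsum1 x +i* fsum2 x)%C) (normc_fsum x).
Qed.

Lemma integrable_tr b k : intble (@tr R d b k).
Proof. exact: integrable_bounded (@measurable_tr R d b k) (@normr_tr_le1 R d b k). Qed.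

(** Orthogonality: the products of the term at [k] with the harmonics at [l] combine to harmonics at
    [k - l] alone, whose integrals vanish unless [k = l]. *)
Lemma ccoef_psum n l : l \in terms n ->
  ccoef (fun x => complex.Re (psum n x)) (fun x => complex.Im (psum n x)) l = c l.
Proof.
move=> ln.
have iRe : intble (fun x => complex.Re (psum n x)).
  exact: (@integrable_bounded _ _ P _ C (@measurable_Re_psum n) (@Re_psum_le n)).
have iIm : intble (fun x => complex.Im (psum n x)).
  exact: (@integrable_bounded _ _ P _ C (@measurable_Im_psum n) (@Im_psum_le n)).
pose kl k : freq d := [tuple tnth k j - tnth l j | j < d].
have kl0 k : (kl k == freq0 d) = (k == l).
  apply/eqP/eqP => [h|->]; apply: eq_from_tnth => j; last by rewrite !tnth_mktuple subrr.
  by have := congr1 (fun t => tnth t j) h; rewrite !tnth_mktuple => /eqP;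
    rewrite subr_eq0 => /eqP.
have sumkl (F : freq d -> R) : \sum_(k <- terms n) F k * (k == l)%:R = F l.
  rewrite (bigD1_seq l) ?uniq_terms//= eqxx mulr1 big1 ?addr0//.
  by move=> k /negbTE ->; rewrite mulr0.
have cl : c l = (complex.Re (c l) +i* complex.Im (c l))%C by case: (c l).
rewrite [RHS]cl /ccoef; congr (_ +i* _)%C; rewrite /coef.
- rewrite -RintegralD//; [|exact: integrable_mul_tr|exact: integrable_mul_tr].
  transitivity (\int[P]_x \sum_(k <- terms n) (complex.Re (c k) * tr true (kl k) x -
      complex.Im (c k) * tr false (kl k) x)).
    apply: eq_Rintegral => x _; rewrite Re_sum Im_sum !mulr_suml -big_split/=.
    by apply: eq_bigr => k _; rewrite /tr phaseB cosB sinB; ring.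
  rewrite Rintegral_sum_fun; last first.
    by move=> k _; apply: integrableB_fun; apply: integrableZ_fun; exact: integrable_tr.
  rewrite -(sumkl (fun k => complex.Re (c k))); apply: eq_bigr => k _.
  rewrite RintegralB//; [|by apply: integrableZ_fun; exact: integrable_tr..].
  rewrite !RintegralZl//; [|exact: integrable_tr..].
  by rewrite !Rintegral_tr//= kl0 mulr0 subr0.
- rewrite -RintegralB//; [|exact: integrable_mul_tr|exact: integrable_mul_tr].
  transitivity (\int[P]_x \sum_(k <- terms n) (complex.Re (c k) * tr false (kl k) x +
      complex.Im (c k) * tr true (kl k) x)).
    apply: eq_Rintegral => x _; rewrite Re_sum Im_sum !mulr_suml -sumrB/=.
    by apply: eq_bigr => k _; rewrite /tr phaseB cosB sinB; ring.
  rewrite Rintegral_sum_fun; last first.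
    by move=> k _; apply: integrableD_fun; apply: integrableZ_fun; exact: integrable_tr.
  rewrite -(sumkl (fun k => complex.Im (c k))); apply: eq_bigr => k _.
  rewrite RintegralD//; [|by apply: integrableZ_fun; exact: integrable_tr..].
  rewrite !RintegralZl//; [|exact: integrable_tr..].
  by rewrite !Rintegral_tr//= kl0 mulr0 add0r.
Qed.

(** By bounded convergence the coefficients of the partial sums tend to those of the sum, and the
    one at [l] equals [c l] as soon as [l] has been enumerated. *)
Lemma ccoef_fsum l : ccoef fsum1 fsum2 l = c l.
Proof.
have lim (b : bool) (u : nat -> T -> R) v : (forall n, measurable_fun [set: T] (u n)) ->
    (forall n x, `|u n x| <= C) -> (forall x, u n x @[n --> \oo] --> v x) ->
    coef P b l (u n) @[n --> \oo] --> coef P b l v.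
  move=> mu bu cu.
  (* Here the harmonic is the fixed integrable factor and the partial sums form the bounded
     sequence. *)
  have co w : coef P b l w = \int[P]_x (tr b l x * w x).
    by apply: eq_Rintegral => x _; rewrite mulrC.
  rewrite co; under eq_fun do rewrite co.
  exact: (cvg_Rintegral_bounded (integrable_tr b l) mu bu cu).
have l1 b := lim b _ _ measurable_Re_psum Re_psum_le (@cvg_Re_psum).
have l2 b := lim b _ _ measurable_Im_psum Im_psum_le (@cvg_Im_psum).
have cst (u : nat -> R) (a b : R) : (forall n, (pickle l < n)%N -> u n = b) ->
    u @ \oo --> a -> a = b.
  move=> ub ua; apply: (cvg_unique _ ua) => //.
  by apply: cvg_near_cst; near=> n; apply: ub; near: n; exact: nbhs_infty_gt.
have cl : c l = (complex.Re (c l) +i* complex.Im (c l))%C by case: (c l).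
rewrite [RHS]cl /ccoef; congr (_ +i* _)%C.
- apply: cst (cvgD (l1 true) (l2 false)) => n ln.
  by have := ccoef_psum (mem_terms ln); rewrite cl => -[].
- apply: cst (cvgB (l2 true) (l1 false)) => n ln.
  by have := ccoef_psum (mem_terms ln); rewrite cl => -[].
Unshelve. all: by end_near. Qed.

End Series.

Lemma ae_normc_le_sum_ccoef (g h : T -> R) (C : R) : intble g -> intble h ->
  (forall s : seq (freq d), uniq s -> \sum_(k <- s) Normc.normc (ccoef g h k) <= C) ->
  {ae P, forall x, Normc.normc (g x +i* h x)%C <= C}.
Proof.
move=> ig ih sC; pose c := ccoef g h.
have i1 := integrable_fsum1 sC; have i2 := integrable_fsum2 sC.
have d1 := integrableB_fun ig i1; have d2 := integrableB_fun ih i2.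
have c0 k : ccoef (fun x => g x - fsum1 c x) (fun x => h x - fsum2 c x) k = 0.
  have := ccoef_fsum sC k; rewrite -/c /c /ccoef !coefB// => -[e1 e2].
  by apply/eqP; rewrite eq_complex/=; apply/andP; split; apply/eqP; lra.
have [k1 k2] := ccoef0 d1 d2 c0.
have a1 := coef_eq0_ae invP d1 k1; have a2 := coef_eq0_ae invP d2 k2.
apply: filterS2 a1 a2 => x /(_ Logic.I) [e1] /(_ Logic.I) [e2].
have -> : g x = fsum1 c x by apply/eqP; rewrite -subr_eq0; apply/eqP.
have -> : h x = fsum2 c x by apply/eqP; rewrite -subr_eq0; apply/eqP.
exact: normc_fsum.
Qed.

End AbsolutelySummable.

(** * ANOVA terms *)

Section AnovaParts.
Variables (R : realType) (d : nat).
Local Notation T := (pt R d).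
Implicit Types (u v : {set 'I_d}) (g h : T -> R) (f : T -> R[i]).

Lemma Re_intcoords s f x :
  complex.Re (intcoords s f x) = rint s (fun y => complex.Re (f y)) x.
Proof. by elim: s x => //= i s ih x; apply: eq_Rintegral => t _; exact: ih. Qed.

Lemma Im_intcoords s f x :
  complex.Im (intcoords s f x) = rint s (fun y => complex.Im (f y)) x.
Proof. by elim: s x => //= i s ih x; apply: eq_Rintegral => t _; exact: ih. Qed.

Lemma rint_box01 s g h x : (forall y, box01 y -> g y = h y) -> box01 x ->
  rint s g x = rint s h x.
Proof.
move=> gh; elim: s x => [|i s ih] x bx /=; first exact: gh.
apply: eq_Rintegral => t; rewrite inE/= in_itv/= => t01.
by apply: ih; exact: box01_upd.
Qed.

(** Partial integration and sums act separately on real and imaginary parts, so the ANOVA recursion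
    can be run on each part. *)
Fixpoint ranova (n : nat) g u : T -> R :=
  match n with
  | 0 => rint (enum (~: u)) g
  | n'.+1 => fun x =>
      rint (enum (~: u)) g x - \sum_(v : {set 'I_d} | v \proper u) ranova n' g v x
  end.

Lemma Re_anova_aux n f u x :
  complex.Re (anova_aux n f u x) = ranova n (fun y => complex.Re (f y)) u x.
Proof.
elim: n u x => [|n ih] u x /=; first exact: Re_intcoords.
rewrite ReD ReN Re_sum Re_intcoords; congr (_ - _).
by apply: eq_bigr => v _; exact: ih.
Qed.

Lemma Im_anova_aux n f u x :
  complex.Im (anova_aux n f u x) = ranova n (fun y => complex.Im (f y)) u x.
Proof.
elim: n u x => [|n ih] u x /=; first exact: Im_intcoords.
rewrite ImD ImN Im_sum Im_intcoords; congr (_ - _).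
by apply: eq_bigr => v _; exact: ih.
Qed.

Lemma ranova_box01 n g h u x : (forall y, box01 y -> g y = h y) -> box01 x ->
  ranova n g u x = ranova n h u x.
Proof.
move=> gh bx; elim: n u => [|n ih] u /=; first exact: rint_box01.
rewrite (rint_box01 _ gh bx); congr (_ - _).
by apply: eq_bigr => v _; exact: ih.
Qed.

Definition suppf (k : freq d) : {set 'I_d} := [set j | tnth k j != 0].

Lemma FfreqE u : @Ffreq d u = [set k | suppf k == u].
Proof.
apply/seteqP; split => k /=; rewrite /Ffreq/=.
  move=> [h0 h1]; apply/eqP/setP => j; rewrite inE.
  by have [ju|ju] := boolP (j \in u); [rewrite h1|rewrite h0// eqxx].
by move=> /eqP <-; split=> j; rewrite inE// negbK => /eqP.
Qed.

Variable P : probability T R.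
Hypothesis invP : invariant P.
Local Notation intble g := (P.-integrable [set: T] (EFin \o g)).

(** [P_u] keeps the frequencies supported inside [u]; by induction the proper subsets remove all of
    them but those with support exactly [u]. Fuel [#|u|] is enough, since for the empty set the
    fuel-0 value is already the ANOVA term. *)
Lemma coef_ranova n g u b k : intble g -> (#|u| <= n)%N ->
  intble (ranova n g u) /\
  coef P b k (ranova n g u) = if suppf k == u then coef P b k g else 0.
Proof.
move=> ig; elim: n u => [|n ih] u un /=.
  have -> : u = finset.set0 by apply/eqP; rewrite -cards_eq0 -leqn0.
  split; first exact: integrable_rint.
  rewrite coef_rint//; congr (if _ then _ else _).
  apply/allP/eqP => [h|h j _].
    apply/setP => j; rewrite !inE; apply/negbTE; rewrite negbK.
    by apply: h; rewrite mem_enum !inE.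
  by have := finset.in_set0 j; rewrite -h inE => /negbFE.
have ihv v : v \proper u -> intble (ranova n g v) /\
    coef P b k (ranova n g v) = if suppf k == v then coef P b k g else 0.
  by move=> /proper_card vu; apply: ih; rewrite -ltnS (leq_trans vu).
have iP : intble (rint (enum (~: u)) g) by exact: integrable_rint.
have iS : intble (fun x => \sum_(v : {set 'I_d} | v \proper u) ranova n g v x).
  by apply: integrable_sum_fun => v /ihv[].
split; first exact: integrableB_fun.
rewrite coefB// coef_sum; last by move=> v /ihv[].
rewrite (eq_bigr (fun v => if suppf k == v then coef P b k g else 0)); last
  by move=> v /ihv[].
rewrite coef_rint//.
have -> : all (fun i => tnth k i == 0) (enum (~: u)) = (suppf k \subset u).
  apply/allP/fintype.subsetP => [h j|h j].
    rewrite inE; apply: contraR => ju; apply: h.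
    by rewrite mem_enum inE.
  by rewrite mem_enum inE; apply: contraR => kj; apply: h; rewrite inE.
have [ku|ku] := boolP (suppf k \proper u).
  rewrite (proper_sub ku) (bigD1 (suppf k))//= eqxx big1 ?addr0 ?subrr; last first.
    by move=> v /andP[_ /negbTE vk]; rewrite eq_sym vk.
  by case: eqP => // E; move: ku; rewrite E fintype.properxx.
rewrite big1 ?subr0; last first.
  by move=> v vu; case: eqP => // kv; move: ku; rewrite kv vu.
case: eqP => [->|/eqP E]; first by rewrite subxx.
by case: ifPn => // ku'; move: ku; rewrite finset.properEneq E ku'.
Qed.

End AnovaParts.

(** * From iterated integrals of [f] to integrals against [P] *)

Section FourierL1.
Variables (R : realType) (d : nat) (P : probability (pt R d) R).
Hypothesis invP : invariant P.
Local Notation T := (pt R d).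
Local Notation intble g := (P.-integrable [set: T] (EFin \o g)).
Local Notation origin := ([tuple 0%R | _ < d] : T).

Lemma box01_origin : box01 origin.
Proof. by move=> j; rewrite tnth_mktuple lexx ltr01. Qed.

Local Open Scope ereal_scope.

Definition eavg (s : seq 'I_d) (h : T -> \bar R) := foldr (@avg R d) h s.

Lemma eavg_ge0 s h : (forall x, 0 <= h x) -> forall x, 0 <= eavg s h x.
Proof. by move=> h0; elim: s => //= i s ih; exact: avg_ge0. Qed.

Lemma measurable_eavg s h : measurable_fun [set: T] h -> (forall x, 0 <= h x) ->
  measurable_fun [set: T] (eavg s h).
Proof.
move=> mh h0; elim: s => //= i s ih.
by apply: (@measurable_avg R d i _ ih); exact: eavg_ge0.
Qed.

Lemma integral_eavg s h : measurable_fun [set: T] h -> (forall x, 0 <= h x) ->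
  \int[P]_x eavg s h x = \int[P]_x h x.
Proof.
move=> mh h0; elim: s => //= i s <-.
by rewrite [RHS](invP i)//; [exact: measurable_eavg|exact: eavg_ge0].
Qed.

Lemma eavg_upd i s h x t : i \in s -> eavg s h (upd x i t) = eavg s h x.
Proof.
elim: s x => //= j s ih x; rewrite inE; case: (eqVneq i j) => [-> _|ij /= si].
  by apply: eq_integral => u _; rewrite upd_upd.
by apply: eq_integral => u _; rewrite (upd_comm _ _ _ ij) ih.
Qed.

(** Agreement on the box is enough: iterated integrals started inside the box never leave it. *)
Lemma eintcoords_eavg s (h k : T -> \bar R) x : measurable_fun [set: T] k ->
  (forall y, 0 <= k y) -> (forall y, box01 y -> h y = k y) -> box01 x ->
  eintcoords s h x = eavg s k x.
Proof.
move=> mk k0 hk; elim: s x => [|i s ih] x bx /=; first exact: hk.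
rewrite /avg integral_lam; last first.
  by apply: (measurableT_comp (@measurable_eavg s k mk k0)); exact: measurable_upd1.
apply: eq_integral => t; rewrite inE/= in_itv/= => t01.
by apply: ih; exact: box01_upd.
Qed.

Lemma eintcoords_full (h k : T -> \bar R) : measurable_fun [set: T] k ->
  (forall y, 0 <= k y) -> (forall y, box01 y -> h y = k y) ->
  eintcoords (enum [set: 'I_d]) h origin = \int[P]_x k x.
Proof.
move=> mk k0 hk; rewrite (eintcoords_eavg _ mk k0 hk box01_origin).
rewrite -(integral_eavg (enum [set: 'I_d]) mk k0).
transitivity (\int[P]_x (cst (eavg (enum [set: 'I_d]) k origin) x)).
  by rewrite (integral_cst P measurableT) [X in _ * X]probability_setT mule1.
apply: eq_integral => x _ /=; apply: (@upd_invariant_const R d) => i z t.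
by rewrite eavg_upd// mem_enum in_setT.
Qed.

Local Close Scope ereal_scope.

Variable f : T -> R[i].
Hypothesis L1f : L1 f.

(** [f] is measurable on the box only; extending its parts by 0 gives functions measurable on the
    whole space, with the same iterated integrals from points of the box. *)
Definition ReT : T -> R := (fun x => complex.Re (f x)) \_ (@box01 R d).
Definition ImT : T -> R := (fun x => complex.Im (f x)) \_ (@box01 R d).

Lemma measurable_ReT : measurable_fun [set: T] ReT.
Proof.
have [mre _] := L1f.
by apply/(measurable_restrictT _ (@measurable_box01 R d)); exact: mre.
Qed.

Lemma measurable_ImT : measurable_fun [set: T] ImT.
Proof.
have [_ [mim _]] := L1f.
by apply/(measurable_restrictT _ (@measurable_box01 R d)); exact: mim.
Qed.

Lemma ReT_box01 x : box01 x -> complex.Re (f x) = ReT x.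
Proof. by move=> bx; rewrite /ReT patchE mem_set. Qed.

Lemma ImT_box01 x : box01 x -> complex.Im (f x) = ImT x.
Proof. by move=> bx; rewrite /ImT patchE mem_set. Qed.

Lemma integrable_normT : intble (fun x => Normc.normc (ReT x +i* ImT x)%C).
Proof.
have mn : measurable_fun [set: T] (fun x => Normc.normc (ReT x +i* ImT x)%C).
  under eq_fun do rewrite normcE/=.
  apply: measurableT_comp; first exact: continuous_measurable_fun (@sqrt_continuous R).
  by apply: measurable_funD; apply: measurable_funX;
    [exact: measurable_ReT|exact: measurable_ImT].
apply/integrableP; split; first exact/measurable_EFinP.
have [_ [_]] := L1f; rewrite (@eintcoords_full _ (fun x =>
  (Normc.normc (ReT x +i* ImT x)%C)%:E)).
- by under [X in (_ -> X < _)%E]eq_integral => x _ do rewrite /= ger0_norm ?normc_ge0//.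
- exact/measurable_EFinP.
- by move=> y; rewrite lee_fin normc_ge0.
- move=> y yb; rewrite -ReT_box01// -ImT_box01//.
  by case: (f y).
Qed.

Lemma integrable_ReT : intble ReT.
Proof.
apply: (le_integrable measurableT _ _ integrable_normT).
  by apply/measurable_EFinP; exact: measurable_ReT.
move=> x _ /=; rewrite lee_fin [leRHS]ger0_norm ?normc_ge0//.
exact: (normc_Re (ReT x +i* ImT x)%C).
Qed.

Lemma integrable_ImT : intble ImT.
Proof.
apply: (le_integrable measurableT _ _ integrable_normT).
  by apply/measurable_EFinP; exact: measurable_ImT.
move=> x _ /=; rewrite lee_fin [leRHS]ger0_norm ?normc_ge0//.
exact: (normc_Im (ReT x +i* ImT x)%C).
Qed.

Lemma fcoefE k : fcoef f k = ccoef P ReT ImT k.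
Proof.
have iR := integrable_ReT; have iI := integrable_ImT.
have -> : fcoef f k = (complex.Re (fcoef f k) +i* complex.Im (fcoef f k))%C
  by case: fcoef.
have ph x : 2 * pi * - kdot k x = - phase k x :> R by rewrite mulrN.
rewrite /ccoef; congr (_ +i* _)%C; rewrite /fcoef /coef.
- rewrite Re_intcoords -RintegralD//;
  [|exact: integrable_mul_tr|exact: integrable_mul_tr].
  rewrite -(rint_full invP origin); last first.
    by apply: integrableD_fun; exact: integrable_mul_tr.
  apply: rint_box01; last exact: box01_origin.
  move=> y yb; rewrite -ReT_box01// -ImT_box01// /expi2pi ph cosN sinN /tr.
  by case: (f y) => p q /=; ring.
- rewrite Im_intcoords -RintegralB//;
  [|exact: integrable_mul_tr|exact: integrable_mul_tr].
  rewrite -(rint_full invP origin); last first.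
    by apply: integrableB_fun; exact: integrable_mul_tr.
  apply: rint_box01; last exact: box01_origin.
  move=> y yb; rewrite -ReT_box01// -ImT_box01// /expi2pi ph cosN sinN /tr.
  by case: (f y) => p q /=; ring.
Qed.

Lemma nullset_anova (u : {set 'I_d}) (C : R) : (0 < d)%N ->
  (forall s : seq (freq d), uniq s ->
     \sum_(k <- s | suppf k == u) Normc.normc (fcoef f k) <= C) ->
  nullset [set x | box01 x /\ C < Normc.normc (anova f u x)].
Proof.
move=> d0 hC.
pose g := ranova #|u|.+1 ReT u; pose h := ranova #|u|.+1 ImT u.
have hg b k := coef_ranova invP b k integrable_ReT (leqnSn #|u|).
have hh b k := coef_ranova invP b k integrable_ImT (leqnSn #|u|).
have ig : intble g by have [] := hg true (freq0 d).
have ih : intble h by have [] := hh true (freq0 d).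
have cE k : ccoef P g h k = if suppf k == u then fcoef f k else 0.
  rewrite fcoefE /ccoef (hg _ _).2 (hg _ _).2 (hh _ _).2 (hh _ _).2.
  by case: ifPn => // _; rewrite addr0 subr0.
have sC s : uniq s -> \sum_(k <- s) Normc.normc (ccoef P g h k) <= C.
  move=> us; apply: le_trans (hC _ us); rewrite [leRHS]big_mkcond.
  by apply: ler_sum => k _; rewrite cE; case: ifPn => // _; rewrite Normc.normc0.
have [N [mN N0 hN]] := ae_normc_le_sum_ccoef invP ig ih sC.
have mb := @measurable_box01 R d.
(* Cutting the [P]-null set [N] down to the box makes it a null set in the sense of box covers. *)
have nbN : nullset (@box01 R d `&` N).
  apply: (nullset_probability0 d0 invP).
  - exact: measurableI.
  - by move=> x [].
  - apply/eqP; rewrite -measure_le0 -N0.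
    by apply: le_measure; rewrite ?inE//; exact: measurableI.
refine (nullset_sub d0 _ nbN) => x [bx Cx]; split => //; apply: hN => /= hle.
move: Cx; rewrite ltNge => /negP; apply.
suff -> : anova f u x = (g x +i* h x)%C by [].
have cE' (z : R[i]) : z = (complex.Re z +i* complex.Im z)%C by case: z.
rewrite [LHS]cE' /anova Re_anova_aux Im_anova_aux.
by rewrite (ranova_box01 _ _ ReT_box01 bx) (ranova_box01 _ _ ImT_box01 bx).
Qed.

End FourierL1.

(** * The estimate *)

Section FrequencySums.
Variables (R : realType) (d : nat) (f : pt R d -> R[i]).
Local Open Scope ereal_scope.

Lemma abscoef_sum_ge0 K : 0 <= abscoef_sum f K.
Proof. by apply: esum_ge0 => k _; rewrite lee_fin normc_ge0. Qed.

Lemma sum_le_abscoef_sum (u : {set 'I_d}) (s : seq (freq d)) : uniq s ->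
  (\sum_(k <- s | suppf k == u) Normc.normc (fcoef f k))%:E <= abscoef_sum f (@Ffreq d u).
Proof.
move=> us; rewrite FfreqE; apply: esum_ge.
exists [set` [seq k <- s | suppf k == u]].
  split; first exact: finite_seq.
  by move=> k /=; rewrite mem_filter => /andP[].
rewrite -fsbig_seq; last exact: filter_uniq.
by rewrite big_filter -sumEFin.
Qed.

(** The sets [Ffreq u] are pairwise disjoint: a frequency [k] contributes for [u = suppf k] at
    most. *)
Lemma sum_abscoef_sum (A : {set {set 'I_d}}) :
  \sum_(u in A) abscoef_sum f (@Ffreq d u) <= abscoef_sum f [set: freq d].
Proof.
rewrite /abscoef_sum.
under eq_bigr => u _ do rewrite esum_mkcond.
rewrite -esum_sum; last first.
  by move=> k u _ _; case: ifPn => // _; rewrite lee_fin normc_ge0.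
apply: le_esum => k _.
have [kA|kA] := boolP (suppf k \in A).
  rewrite (bigD1 (suppf k))//= big1 ?adde0; last first.
    move=> u /andP[_ uk]; rewrite ifF//; apply/negbTE; rewrite notin_setE FfreqE /=.
    by rewrite eq_sym; exact/negP.
  by rewrite FfreqE ifT// inE/=.
rewrite big1 ?lee_fin ?normc_ge0// => u uA.
rewrite ifF//; apply/negbTE; rewrite notin_setE FfreqE /= => /eqP ku.
by move: kA; rewrite ku uA.
Qed.

Lemma abscoef_sum_le_Awnorm (w : freq d -> R) : (forall k, 1 <= w k)%R ->
  abscoef_sum f [set: freq d] <= Awnorm w f.
Proof.
move=> w1; apply: le_esum => k _.
by rewrite lee_fin ler_peMl ?normc_ge0.
Qed.

End FrequencySums.

(** * Truncation error and ratios of norms *)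

Section FinalEstimate.
Variables (R : realType) (d : nat).
Hypothesis d_gt0 : (0 < d)%N.
Local Open Scope ereal_scope.

Lemma nullset_bigU (I : finType) (A : {pred I}) (N : I -> set (pt R d)) :
  (forall i, i \in A -> nullset (N i)) ->
  nullset [set x | exists2 i, i \in A & N i x].
Proof.
move=> hN; have : forall s : seq I, {subset s <= A} ->
    nullset [set x | exists2 i, i \in s & N i x].
  elim=> [|i s ih] sA.
    refine (@nullset_sub R d d_gt0 _ set0 _ _); first by move=> x [].
    by apply/(nullset_boxext d_gt0); exact: outer_measure0.
  refine (nullset_sub d_gt0 _ (nullsetU d_gt0 (hN i _) (ih _))).
  - move=> x [j]; rewrite inE => /predU1P[->|js] Njx; first by left.
    by right; exists j.
  - by apply: sA; rewrite inE eqxx.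
  - by move=> j js; apply: sA; rewrite inE js orbT.
move=> /(_ (enum A)) h; refine (nullset_sub d_gt0 _ (h _)).
  by move=> x [i iA Nix]; exists i => //; rewrite mem_enum.
by move=> i; rewrite mem_enum.
Qed.

(** The strict hypothesis supplies an essential bound [M < B] for the first error. The two errors
    differ by the dropped terms, each bounded outside its own null set, and finitely many null sets
    are discarded. *)
Lemma Linf_TU_le (f : pt R d -> R[i]) (V U : {set {set 'I_d}}) (B : R) :
  L1 f -> U \subset V ->
  (forall u, u \in V :\: U -> abscoef_sum f (@Ffreq d u) < +oo) ->
  Linf (fun x => (f x - TU V f x)%R) < B%:E ->
  Linf (fun x => (f x - TU U f x)%R) <=
    B%:E + \sum_(u in V :\: U) abscoef_sum f (@Ffreq d u).
Proof.
move=> L1f UV fin /ereal_inf_lt[M nM MB].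
have [P invP] := exists_invariant R d.
pose C u := fine (abscoef_sum f (@Ffreq d u)).
have CE u : u \in V :\: U -> abscoef_sum f (@Ffreq d u) = (C u)%:E.
  by move=> uV; rewrite fineK// ge0_fin_numE ?abscoef_sum_ge0// fin.
rewrite (eq_bigr (fun u => (C u)%:E)) // sumEFin -EFinD.
apply: ereal_inf_lbound => /=.
have nC : nullset [set x | exists2 u, u \in V :\: U &
    box01 x /\ (C u < Normc.normc (anova f u x))%R].
  apply: nullset_bigU => u uV; apply: (nullset_anova invP L1f d_gt0) => s us.
  by rewrite -lee_fin -CE//; exact: sum_le_abscoef_sum.
refine (nullset_sub d_gt0 _ (nullsetU d_gt0 nM nC)) => x [bx hx].
apply: contrapT => /not_orP[h1 h2].
have {}h1 : (Normc.normc (f x - TU V f x) <= B)%R.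
  rewrite -lee_fin; apply: le_trans (ltW MB); rewrite leNgt; apply/negP => h.
  by apply: h1.
have {}h2 u : u \in V :\: U -> (Normc.normc (anova f u x) <= C u)%R.
  by move=> uV; rewrite leNgt; apply/negP => h; apply: h2; exists u.
move: hx; rewrite lte_fin ltNge => /negP; apply.
have -> : (f x - TU U f x = (f x - TU V f x) + \sum_(u in V :\: U) anova f u x)%R.
  have -> : (TU V f x = TU U f x + \sum_(u in V :\: U) anova f u x)%R.
    by rewrite /TU (big_setID U)/= (finset.setIidPr UV).
  by rewrite opprD addrA subrK.
apply: le_trans (le_normcD _ _) _; apply: lerD => //.
apply: le_trans (normc_sum _ _ _) _; exact: ler_sum.
Qed.

(* For [A = 0] division is multiplication by [+oo] here. *)
Lemma lee_ratio (L L' A S : \bar R) (e e' : R) : 0 <= A -> A < +oo ->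
  (0 < e)%R -> (0 <= e')%R -> S <= e'%:E * A ->
  L / A < e%:E ->
  (forall B : R, L < B%:E -> L' <= B%:E + S) ->
  L' / A <= (e + e')%:E.
Proof.
move=> A0 Ay e0 e'0 SA LA hL.
have [A00|A00] := eqVneq A 0.
  move: LA SA; rewrite A00 mule0 inve0 => LA S0.
  have L0 : L <= 0.
    by rewrite leNgt; apply/negP => L0; move: LA; rewrite gt0_muley.
  (* Since [L <= 0], every positive [B] is admissible in [hL]. *)
  have L'0 : L' <= 0.
    apply/lee_addgt0Pr => B B0; rewrite add0e.
    apply: le_trans (hL B _) _; first by apply: le_lt_trans L0 _; rewrite lte_fin.
    by rewrite -[leRHS]adde0 leeD2l.
  apply: (@le_trans _ _ 0); first by rewrite mule_le0_ge0.
  by rewrite lee_fin addr_ge0// ltW.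
have Afin : A \is a fin_num by rewrite ge0_fin_numE.
pose a := fine A; have AE : A = a%:E by rewrite fineK.
have a0 : (0 < a)%R by rewrite -lte_fin -AE lt_def A00 A0.
have iE : (a%:E)^-1 = (a^-1)%:E by rewrite inver gt_eqF.
move: LA SA; rewrite AE iE => LA SA.
rewrite lee_pdivrMr// -EFinM mulrDl EFinD.
(* [B = e * a] is admissible because [LA] means [L < e * a]. *)
apply: le_trans (hL (e * a)%R _) _; first by rewrite EFinM -lte_pdivrMr.
by rewrite leeD2l.
Qed.

End FinalEstimate.

Theorem theorem6p2 (R : realType) (d ds : nat) (w : freq d -> R)
  (f : pt R d -> R[i]) (U : {set {set 'I_d}}) (eps1 eps2 : R) :
  (1 <= ds <= d)%N ->
  (forall k, 1 <= w k) ->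
  in_Aw w f ->
  downward_closed U -> U \subset Uds d ds ->
  0 < eps1 ->
  (forall u, u \in Uds d ds :\: U ->
     (abscoef_sum f (Ffreq u) / abscoef_sum f [set: freq d] < eps1%:E)%E) ->
  0 < eps2 ->
  (Linf (fun x => (f x - Tds ds f x)%R) / Awnorm w f < eps2%:E)%E ->
  (Linf (fun x => (f x - TU U f x)%R) / Awnorm w f <=
     (eps2 + Num.sqrt (#|Uds d ds :\: U|%:R * eps1))%R%:E)%E.
Proof.
move=> /andP[ds1 dsd] w1 [L1f Afin] _ UV e1 hu e2 hL.
have d0 : (0 < d)%N := leq_trans ds1 dsd.
set V := Uds d ds in UV hu *; set n := #|V :\: U|.
have A0 : (0 <= Awnorm w f)%E.
  by apply: esum_ge0 => k _; rewrite lee_fin mulr_ge0 ?normc_ge0// (le_trans _ (w1 k)).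
(* As [w >= 1], the unweighted sum is finite, and bounding the dropped terms by a multiple of it
   bounds them by the same multiple of the norm. *)
have TA := abscoef_sum_le_Awnorm f w1.
set S := abscoef_sum f [set: freq d] in TA hu *.
have S0 : (0 <= S)%E := abscoef_sum_ge0 f _.
have Sy : (S < +oo)%E := le_lt_trans TA Afin.
have sumS : (\sum_(u in V :\: U) abscoef_sum f (Ffreq u) <= S)%E := sum_abscoef_sum f _.
have uS u : u \in V :\: U -> (abscoef_sum f (Ffreq u) <= S)%E.
  move=> uV; apply: le_trans sumS; rewrite (bigD1 u)//= leeDl//.
  by apply: sume_ge0 => v _; exact: abscoef_sum_ge0.
apply: (@lee_ratio R _ _ _ (\sum_(u in V :\: U) abscoef_sum f (Ffreq u))%E _ _
  A0 Afin e2 (sqrtr_ge0 _) _ hL); last first.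
  move=> B LB; apply: (Linf_TU_le d0 L1f UV) => // u uV.
  exact: le_lt_trans (uS u uV) Sy.
(* [min 1 t <= sqrt t], with [t = n * eps1] *)
apply: (@le_trans _ _ ((Num.sqrt (n%:R * eps1))%:E * S)%E); last first.
  by rewrite lee_wpmul2l// lee_fin sqrtr_ge0.
have Sfin : S \is a fin_num by rewrite ge0_fin_numE.
have [t1|t1] := leP 1 (n%:R * eps1).
  apply: le_trans sumS _; rewrite -[leLHS]mul1e lee_wpmul2r// lee_fin.
  by rewrite -[leLHS]sqrtr1 ler_wsqrtr.
have t0 : 0 <= n%:R * eps1 by rewrite mulr_ge0// ltW.
have ts : n%:R * eps1 <= Num.sqrt (n%:R * eps1).
  rewrite -{1}(sqr_sqrtr t0) expr2 ler_piMr ?sqrtr_ge0//.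
  by rewrite -[leRHS]sqrtr1 ler_wsqrtr// ltW.
apply: (@le_trans _ _ ((n%:R * eps1)%:E * S)%E); last by rewrite lee_wpmul2r// lee_fin.
(* For [S = 0] the ratios in [hu] say nothing, but then the dropped terms already sum to at most
   0. *)
have [SE|SN] := eqVneq S 0%E; first by move: sumS; rewrite SE mule0.
have us u : u \in V :\: U -> (abscoef_sum f (Ffreq u) <= eps1%:E * S)%E.
  have s0 : 0 < fine S by rewrite fine_gt0// lt_def SN S0.
  move=> /hu; rewrite -[S]fineK// inver gt_eqF// lte_pdivrMr//; exact: ltW.
apply: le_trans (lee_sum _ us) _.
rewrite -[S]fineK// -EFinM sumEFin lee_fin big_const iter_addr_0 -/n.
by rewrite -[leLHS]mulr_natl mulrA.
Qed.
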